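(* Let $X\subseteq 2^{\mathbb{Z}}$ be an infinite minimal subshift of finite symbolic rank. Then $(X,\sigma)$ has finite topological rank.
   Context: **Subshifts.** $2^{\mathbb{Z}}=\{0,1\}^{\mathbb{Z}}$ has the product topology, $\sigma(x)(n)=x(n+1)$. A subshift is a closed set $X\subseteq 2^{\mathbb{Z}}$ with $\sigma X=X$, identified with the system $(X,\sigma)$; it is minimal if every orbit $\{\sigma^k x: k\in\mathbb{Z}\}$ is dense in $X$. For an infinite word $V\in\{0,1\}^{\mathbb{N}}$, $X_V=\{x\in 2^{\mathbb{Z}}:$ every finite subword of $x$ is a subword of $V\}$. **Finite symbolic rank.** Let $\mathcal{F}$ be the set of finite $0,1$-words that begin and end with $0$. For finite $S\subseteq\mathcal{F}$ and $w\in\mathcal{F}$, a building of $w$ from $S$ consists of $v_1,\dots,v_{k+1}\in S$ and nonnegative integers $s_1,\dots,s_k$, $k\ge 1$, with $w=v_1 1^{s_1}v_2\cdots v_k1^{s_k}v_{k+1}$; then $w$ is built from $S$ starting with $v_1$. For $n\ge1$, a rank-$n$ generating sequence is a family $\{v_{i,j}\}_{i\ge0,1\le j\le n_i}$ of finite words such that for all $i\ge 0$: $n_i\le n$; $v_{0,j}=0$ for all $1\le j\le n_0$; $v_{i+1,1}$ is built from $S_i=\{v_{i,1},\dots,v_{i,n_i}\}$ starting with $v_{i,1}$; and $v_{i+1,j}$ is built from $S_i$ for all $2\le j\le n_{i+1}$. A rank-$n$ construction is such a sequence together with one chosen building of each $v_{i+1,j}$ from $S_i$ (that of $v_{i+1,1}$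 starting with $v_{i,1}$); it is a construction of the infinite word $V=\lim_i v_{i,1}$. A subshift $X$ has finite symbolic rank if, for some $n\ge1$, $X=X_V$ for some $V$ having a rank-$n$ construction. **Topological rank.** A Cantor system $(X,T)$ is a homeomorphism $T$ of a Cantor space $X$ (zero-dimensional, perfect, compact metrizable); it is essentially minimal if it has a unique minimal set (nonempty closed set $Y$ with $TY=Y$, minimal among such sets). Systems $(X,T)$ and $(Y,S)$ are conjugate if there is a homeomorphism $\varphi:X\to Y$ with $\varphi T=S\varphi$. A Bratteli diagram $(V,E)$ consists of vertices $V=V_0\sqcup V_1\sqcup\cdots$ and edges $E=E_1\sqcup E_2\sqcup\cdots$, all $V_n,E_n$ finite nonempty, $V_0=\{v_0\}$, with maps $\mathsf{s},\mathsf{r}:E\to V$ satisfying $\mathsf{s}(E_n)=V_{n-1}$ and $\mathsf{r}(E_n)=V_n$ for $n\ge1$ (so every vertex is a source, and every vertex other than $v_0$ is a range). It is ordered if it carries a partial order $\preceq$ on $E$ in which $e,e'$ are comparable iff $\mathsf{r}(e)=\mathsf{r}(e')$. Let $X_B=\{(e_n)_{n\ge1}: e_n\in E_n,\ \mathsf{r}(e_n)=\mathsf{s}(e_{n+1})\}$ with the subspace topology of $\prod_n E_n$. The ordered diagram $B$ is essentially simple if there is a unique $x_{\max}\in X_B$ all of whose edges are $\preceq$-maximal and a unique $x_{\min}\in X_B$ all of whose edges are $\preceq$-minimal. Then the Vershik map $\lambda_B$ sends $x_{\max}$ to $x_{\min}$, and sends $(e_1,e_2,\dots)\ne x_{\max}$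 to $(f_1,\dots,f_k,e_{k+1},\dots)$, where $k$ is least with $e_k$ not maximal, $f_k$ is the $\preceq$-successor of $e_k$, and $(f_1,\dots,f_{k-1})$ is the unique path of minimal edges from $v_0$ to $\mathsf{s}(f_k)$. An essentially minimal Cantor system has finite topological rank if it is conjugate to some $(X_B,\lambda_B)$ with $B$ essentially simple and $(|V_n|)_{n\ge1}$ bounded by some natural number $d$; the least possible $d$ is its topological rank. *)

(* Defs.v *)
From HB Require Import structures.
From mathcomp Require Import all_boot all_order all_algebra.
From mathcomp Require Import all_classical all_reals topology cantor.

Set Implicit Arguments.
Unset Strict Implicit.
Unset Printing Implicit Defensive.

Import Order.TTheory GRing.Theory Num.Theory.
Local Open Scope classical_set_scope.
Local Open Scope ring_scope.

Section Systems.
Implicit Types T U : topologicalType.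

Definition homeomorphism T U (f : T -> U) : Prop :=
  continuous f /\
  exists g : U -> T, [/\ cancel f g, cancel g f & continuous g].

Definition metrizable (R : realType) T : Prop :=
  exists d : T -> T -> R,
    [/\ forall x y, d x y = 0 <-> x = y,
        forall x y, d x y = d y x,
        forall x y z, d x z <= d x y + d y z &
        forall (x : T) (A : set T),
          nbhs x A <-> exists2 e : R, 0 < e & [set y | d x y < e] `<=` A].

(* [cantor_like T] : T is perfect, compact, Hausdorff and zero-dimensional. *)
Definition cantor_system (R : realType) T (f : T -> T) : Prop :=
  [/\ [set: T] !=set0, metrizable R T, cantor_like T & homeomorphism f].

Definition invariant_closed T (f : T -> T) (Y : set T) : Prop :=
  [/\ Y !=set0, closed Y & f @` Y = Y].

Definition minimal_set T (f : T -> T) (Y : set T) : Prop :=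
  invariant_closed f Y /\
  forall Z : set T, invariant_closed f Z -> Z `<=` Y -> Z = Y.

Definition essentially_minimal T (f : T -> T) : Prop :=
  exists! Y : set T, minimal_set f Y.

Definition conjugate T U (f : T -> T) (g : U -> U) : Prop :=
  exists phi : T -> U, homeomorphism phi /\ forall x, phi (f x) = g (phi x).

End Systems.

(* 2^Z with the product topology; the topology of [bool] is discrete. *)
Definition full_shift : topologicalType := prod_topology (fun _ : int => bool).

(* [shift_by k] is the k-th iterate of sigma, for k in Z. *)
Definition shift_by (k : int) (x : full_shift) : full_shift :=
  fun n : int => x (n + k).

Definition sigma : full_shift -> full_shift := shift_by 1.

Record subshift := Subshift {
  subshift_set :> set full_shift;
  subshift_closed : closed subshift_set;
  subshift_sigma : sigma @` subshift_set = subshift_set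
}.

Lemma sigma_subshift (X : subshift) (x : X) : sigma (val x) \in (X : set _).
Proof.
have Xx : subshift_set X (val x) := set_mem (valP x).
apply/mem_set; move: (val x) Xx => y Xy.
by rewrite -(subshift_sigma X); exists y.
Qed.

(* The system (X, sigma), X carrying the subspace topology. *)
Definition subshift_map (X : subshift) (x : X) : X :=
  exist _ (sigma (val x)) (sigma_subshift x).

Definition minimal_subshift (X : subshift) : Prop :=
  forall x : full_shift, subshift_set X x ->
    X `<=` closure [set shift_by k x | k in [set: int]].

(* The letters 0 and 1 are [false] and [true]. *)
Definition word := seq bool.

Definition subword_Z (u : word) (x : int -> bool) : Prop :=
  exists a : int, u = mkseq (fun i => x (a + i%:Z)) (size u).

Definition subword_N (u : word) (V : nat -> bool) : Prop :=
  exists a : nat, u = mkseq (fun i => V (a + i)%N) (size u).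

Definition subshift_of_word (V : nat -> bool) : set full_shift :=
  [set x : full_shift | forall u : word, subword_Z u x -> subword_N u V].

(* The set F; the default [true] excludes the empty word. *)
Definition calF : pred word := fun w => ~~ head true w && ~~ last true w.

(* (v_1, [:: (s_1, v_2); ...; (s_k, v_{k+1})]) *)
Record building := Building {
  building_first : word;
  building_rest : seq (nat * word)
}.

(* v_1 1^{s_1} v_2 ... v_k 1^{s_k} v_{k+1} *)
Definition building_word (b : building) : word :=
  building_first b ++
  flatten [seq nseq p.1 true ++ p.2 | p <- building_rest b].

Definition is_building (S : seq word) (w : word) (b : building) : Prop :=
  [/\ all calF S && calF w,
      (0 < size (building_rest b))%N,
      building_first b \in S,
      {in building_rest b, forall p, p.2 \in S} &
      w = building_word b].

Definition built_from (S : seq word) (w : word) : Prop :=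
  exists b, is_building S w b.

Definition built_from_starting (S : seq word) (w v1 : word) : Prop :=
  exists2 b, is_building S w b & building_first b = v1.

(* S_i = {v_{i,1}, ..., v_{i,n_i}} *)
Definition level (ns : nat -> nat) (v : nat -> nat -> word) (i : nat) :
    seq word :=
  [seq v i j | j <- iota 1 (ns i)].

(* Only the values [v i j] with 1 <= j <= [ns i] are meaningful. *)
Definition generating_sequence (n : nat) (ns : nat -> nat)
    (v : nat -> nat -> word) : Prop :=
  [/\ forall i, (1 <= ns i <= n)%N,
      forall j, (1 <= j <= ns 0)%N -> v 0%N j = [:: false],
      forall i, built_from_starting (level ns v i) (v i.+1 1%N) (v i 1%N) &
      forall i j, (2 <= j <= ns i.+1)%N ->
        built_from (level ns v i) (v i.+1 j)].

(* [b i j] is the chosen building of v_{i+1,j} from S_i. *)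
Definition rank_construction (n : nat) (ns : nat -> nat)
    (v : nat -> nat -> word) (b : nat -> nat -> building) : Prop :=
  [/\ generating_sequence n ns v,
      forall i j, (1 <= j <= ns i.+1)%N ->
        is_building (level ns v i) (v i.+1 j) (b i j) &
      forall i, building_first (b i 1%N) = v i 1%N].

Definition word_limit (w : nat -> word) (V : nat -> bool) : Prop :=
  forall m : nat, exists N : nat, forall i : nat, (N <= i)%N ->
    (m < size (w i))%N /\ nth false (w i) m = V m.

Definition has_rank_construction (n : nat) (V : nat -> bool) : Prop :=
  exists ns v b,
    rank_construction n ns v b /\ word_limit (fun i => v i 1%N) V.

Definition finite_symbolic_rank (X : set full_shift) : Prop :=
  exists n V,
    [/\ (1 <= n)%N, has_rank_construction n V & X = subshift_of_word V].

(* [bedge n] is E_{n+1}, the set of edges from V_n to V_{n+1}.  Edges of      *)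
(* distinct levels have distinct ranges, hence are incomparable, so the order *)
(* on E amounts to a family of orders on the E_{n+1}.                         *)
Record ordered_bratteli := OrderedBratteli {
  bvertex : nat -> finType;
  bedge : nat -> finType;
  bsource : forall n, bedge n -> bvertex n;
  brange : forall n, bedge n -> bvertex n.+1;
  ble : forall n, rel (bedge n);
  bvertex0 : #|bvertex 0%N| = 1%N;
  bvertex_gt0 : forall n, (0 < #|bvertex n|)%N;
  bedge_gt0 : forall n, (0 < #|bedge n|)%N;
  bsource_surj : forall n (u : bvertex n), exists e, bsource e = u;
  brange_surj : forall n (u : bvertex n.+1), exists e, brange e = u;
  ble_refl : forall n, reflexive (@ble n);
  ble_anti : forall n, antisymmetric (@ble n);
  ble_trans : forall n, transitive (@ble n);
  ble_comparable : forall n (e e' : bedge n),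
    ble e e' || ble e' e = (brange e == brange e')
}.

Section Vershik.
Variable B : ordered_bratteli.

Definition edge_max n (e : bedge B n) : bool :=
  [forall e', ble e e' ==> (e' == e)].

Definition edge_min n (e : bedge B n) : bool :=
  [forall e', ble e' e ==> (e' == e)].

Definition edge_succ n (e f : bedge B n) : bool :=
  [&& e != f, ble e f &
      [forall g, (ble e g && ble g f) ==> (g == e) || (g == f)]].

Definition edge_sequences : topologicalType :=
  prod_topology (fun n => discrete_topology (bedge B n)).

Definition path_set : set edge_sequences :=
  [set x : edge_sequences |
    forall n, brange (x n : bedge B n) = bsource (x n.+1 : bedge B n.+1)].

(* X_B with the subspace topology *)
Definition path_space : topologicalType := set_type path_set.

Definition path_edge (x : path_space) (n : nat) : bedge B n := val x n.

Definition path_max (x : path_space) : Prop :=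
  forall n, edge_max (path_edge x n).

Definition path_min (x : path_space) : Prop :=
  forall n, edge_min (path_edge x n).

Definition essentially_simple : Prop :=
  (exists! x, path_max x) /\ (exists! x, path_min x).

Definition vershik_rel (x y : path_space) : Prop :=
  (path_max x /\ path_min y) \/
  exists k : nat,
    [/\ forall j, (j < k)%N -> edge_max (path_edge x j),
        ~~ edge_max (path_edge x k),
        edge_succ (path_edge x k) (path_edge y k),
        forall j, (j < k)%N -> edge_min (path_edge y j) &
        forall j, (k < j)%N -> path_edge y j = path_edge x j].

(* The default value [x] is never used when B is essentially simple, see      *)
(* [vershikP] and [vershik_rel_inj] below.                                    *)
Definition vershik (x : path_space) : path_space :=
  xget x [set y | vershik_rel x y].

End Vershik.

Section VershikTheory.
Variable B : ordered_bratteli.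

Local Lemma least_edge n (P : pred (bedge B n)) e0 : P e0 ->
  exists2 e, P e & forall e', P e' -> ble e' e -> e' = e.
Proof.
move=> Pe0.
case: (arg_minnP (fun e => #|[set e' | ble e' e]%SET|) Pe0) => e Pe emin.
exists e => // e' Pe' le_e'e; apply: ble_anti; rewrite le_e'e /=.
have sub : [set g | ble g e']%SET \subset [set g | ble g e]%SET.
  by apply/fintype.subsetP => g; rewrite !inE => /ble_trans; apply.
have : [set g | ble g e']%SET = [set g | ble g e]%SET.
  by apply/eqP; rewrite eqEcard sub emin.
by move=> /setP /(_ e); rewrite !inE ble_refl.
Qed.

Local Lemma min_edge n (u : bvertex B n.+1) :
  exists2 e, brange e = u & edge_min e.
Proof.
have [e0 e0u] := brange_surj u.
have [|e /eqP eu emin] := @least_edge n (fun e => brange e == u) e0.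
  exact/eqP.
exists e => //; apply/forallP => e'; apply/implyP => le_e'e; apply/eqP.
by apply: emin => //; rewrite -eu -ble_comparable le_e'e.
Qed.

Local Lemma succ_edge n (e : bedge B n) : ~~ edge_max e ->
  exists2 f, brange f = brange e & edge_succ e f.
Proof.
rewrite negb_forall => /existsP[f0]; rewrite negb_imply => f0P.
have [f /andP[lef nef] fmin] :=
  @least_edge n (fun f => ble e f && (f != e)) _ f0P.
exists f; first by apply/esym/eqP; rewrite -ble_comparable lef.
rewrite /edge_succ eq_sym nef lef /=; apply/forallP => g; apply/implyP.
move=> /andP[leg lgf]; case: eqVneq => //= ge; apply/eqP.
by apply: fmin => //; rewrite leg ge.
Qed.

Local Lemma min_edge_inj n (e f : bedge B n) :
  edge_min e -> edge_min f -> brange e = brange f -> e = f.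
Proof.
move=> /forallP em /forallP fm /eqP; rewrite -ble_comparable => /orP[h|h].
  by apply/eqP; exact: (implyP (fm e)).
by apply/esym/eqP; exact: (implyP (em f)).
Qed.

Local Lemma succ_edge_inj n (e f g : bedge B n) :
  edge_succ e f -> edge_succ e g -> f = g.
Proof.
move=> /and3P[nf lf /forallP sf] /and3P[ng lg /forallP sg].
have rfg : brange f = brange g.
  transitivity (brange e); first by apply/esym/eqP; rewrite -ble_comparable lf.
  by apply/eqP; rewrite -ble_comparable lg.
move/eqP: rfg; rewrite -ble_comparable => /orP[h|h].
  have /orP[/eqP fe|/eqP//] := implyP (sg f) (introT andP (conj lf h)).
  by rewrite fe eqxx in nf.
have /orP[/eqP ge|/eqP//] := implyP (sf g) (introT andP (conj lg h)).
by rewrite ge eqxx in ng.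
Qed.

Local Lemma min_prefix k (x : forall n, bedge B n) :
  (forall n, (k <= n)%N -> brange (x n) = bsource (x n.+1)) ->
  exists y : forall n, bedge B n,
    [/\ forall n, brange (y n) = bsource (y n.+1),
        forall n, (k <= n)%N -> y n = x n &
        forall n, (n < k)%N -> edge_min (y n)].
Proof.
elim: k x => [|k IH] x cx; first by exists x; split => // n; exact: cx.
have [e er emin] := min_edge (bsource (x k.+1)).
pose x' := eqtype.dfwith x e.
have x'k : x' k = e by rewrite /x' eqtype.dfwith_in.
have x'n n : (k < n)%N -> x' n = x n.
  by move=> kn; rewrite /x' eqtype.dfwith_out // neq_ltn kn.
have [|y [cy yx ymin]] := IH x'.
  move=> n; rewrite leq_eqVlt => /predU1P[<-|kn].
    by rewrite x'k x'n.
  by rewrite !x'n ?cx // ltnW.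
exists y; split => // n kn.
  by rewrite yx ?x'n // ltnW.
move: kn; rewrite ltnS leq_eqVlt => /predU1P[->|/ymin//].
by rewrite yx // x'k.
Qed.

Local Lemma path_edgeP (x : path_space B) n :
  brange (path_edge x n) = bsource (path_edge x n.+1).
Proof. exact: (set_mem (valP x) n). Qed.

Lemma vershikP (x : path_space B) :
  essentially_simple B -> vershik_rel x (vershik x).
Proof.
move=> [_ [xmin [xminP _]]].
suff [y xy] : exists y, vershik_rel x y by exact: (xgetI x xy).
have [xmax|/existsNP[k0 /negP k0P]] := pselect (path_max x).
  by exists xmin; left.
case: (ex_minnP (ex_intro (fun k => ~~ edge_max (path_edge x k)) k0 k0P)).
move=> k kP kmin; have [f fr fs] := succ_edge kP.
pose x' := eqtype.dfwith (path_edge x) f.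
have x'k : x' k = f by rewrite /x' eqtype.dfwith_in.
have x'n n : (k < n)%N -> x' n = path_edge x n.
  by move=> kn; rewrite /x' eqtype.dfwith_out // neq_ltn kn.
have [|y [cy yx ymin]] := @min_prefix k x'.
  move=> n; rewrite leq_eqVlt => /predU1P[<-|kn].
    by rewrite x'k x'n // fr path_edgeP.
  by rewrite !x'n ?path_edgeP // ltnW.
have yP : (y : edge_sequences B) \in @path_set B by exact/mem_set.
pose z : path_space B := exist _ (y : edge_sequences B) yP.
have zE n : path_edge z n = y n by [].
exists z; right; exists k; split.
- by move=> j; rewrite ltnNge; apply: contraNT => /kmin.
- exact: kP.
- by rewrite zE yx // x'k.
- by move=> j jk; rewrite zE ymin.
- by move=> j kj; rewrite zE yx ?x'n // ltnW.
Qed.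

Lemma vershik_rel_inj (x y z : path_space B) :
  essentially_simple B -> vershik_rel x y -> vershik_rel x z -> y = z.
Proof.
move=> [_ [xmin [_ xminU]]] [[xm ym]|[k [xk nxk sk mk ek]]]
  [[xm' zm]|[l [xl nxl sl ml el]]].
- by rewrite -(xminU y) // -(xminU z).
- by rewrite xm in nxl.
- by rewrite xm' in nxk.
have kl : k = l.
  case: (ltngtP k l) => // h; first by rewrite xl in nxk.
  by rewrite xk in nxl.
subst l; apply: val_inj; apply: functional_extensionality_dep => n.
change (path_edge y n = path_edge z n).
have [kn|] := ltnP k n; first by rewrite ek // el.
move=> nk; have {nk} -> : n = (k - (k - n))%N by rewrite subKn.
elim: (k - n)%N => [|i IH]; first by rewrite subn0; exact: succ_edge_inj sk sl.
have [ik|ki] := ltnP i k; last first.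
  move: IH; have /eqP -> : (k - i)%N == 0%N by rewrite subn_eq0.
  by have /eqP -> : (k - i.+1)%N == 0%N by rewrite subn_eq0 ltnW.
have lt : (k - i.+1 < k)%N by rewrite ltn_subrL /= (leq_ltn_trans _ ik).
apply: min_edge_inj; [exact: mk|exact: ml|rewrite !path_edgeP].
by move: IH; rewrite -(subnSK ik) => ->.
Qed.

End VershikTheory.

Definition finite_topological_rank (R : realType) (T : topologicalType)
    (f : T -> T) : Prop :=
  [/\ cantor_system R f, essentially_minimal f &
      exists (d : nat) (B : ordered_bratteli),
        [/\ essentially_simple B,
            forall n : nat, (#|bvertex B n.+1| <= d)%N &
            conjugate f (@vershik B)]].

(* Main.v *)
(* Runs of 1s are bounded in X, so the construction yields, for every L, a
   dictionary of at most d words, all longer than L, such that each window of a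
   point of X occurs in a concatenation of dictionary words.  Such parsings are
   far from unique and need not depend continuously on the point.  To choose
   one continuously, let z in X have z[0, n) lexicographically largest, n large:
   no square is centred at 0 in z, so a dictionary word covers position 0 of z
   in at most one way.  Use a long central word of z as a marker, and between
   two consecutive markers pick a parsing that depends only on the word read
   there.  Around a marker the parsings on both sides are glued by a word that
   is determined by the two dictionary words covering the marker.  This gives
   clopen bases inside arbitrarily small cylinders with at most d^2 + d^4 return
   words.  Each base may be chosen inside a small cylinder of the previous one,
   and the resulting nested tower partitions form the Bratteli diagram. *)

Require Import Defs.
From mathcomp Require Import all_boot all_order all_algebra.
From mathcomp Require Import all_classical all_reals topology.
From mathcomp Require Import zify.

Set Implicit Arguments.
Unset Strict Implicit.
Unset Printing Implicit Defensive.

Import Order.TTheory GRing.Theory Num.Theory.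
Local Open Scope classical_set_scope.

(** * Towers and Bratteli diagrams *)

(** The number of towers must stay bounded as the cylinder shrinks, while neither the length of the
    marker nor the number of words between two markers is under control. Base points are therefore
    not put at the markers. Each dictionary word lying between two markers carries one, at an
    occurrence of the target window, which it contains as soon as it is longer than a recurrence gap
    plus the window. A return then sees two neighbouring words, or four when it crosses a marker;
    this is the origin of [d^2 + d^4]. The longest dictionary word, of length [K], is not bounded in
    terms of the shortest, so the dictionary comes first, and [z] and the marker are adapted to [K].
    Aperiodicity enters twice: it excludes squares at the centre of the marker, and it keeps markers
    more than [2K] apart, so that every block contains a whole word. The parsing of a block is
    arbitrary, but it is a function of a finite text; this alone makes the base clopen and its
    construction commute with the shift. *)

Lemma nested_closed_nonempty (T : topologicalType) (F : nat -> set T) :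
  compact [set: T] -> (forall n, closed (F n)) ->
  (forall n, F n !=set0) -> (forall n, F n.+1 `<=` F n) ->
  exists x, forall n, F n x.
Proof.
move=> cT cF F0 FS.
have Fle m n : (m <= n)%N -> F n `<=` F m.
  by move=> /subnK <-; elim: (n - m)%N => {n} // k IH x /FS /IH.
have [u uP] : exists u : nat -> T, forall n, F n (u n).
  by have [u uP] := choice F0; exists u.
have [x [_ xcl]] := cT (u @ \oo) _ filterT.
exists x => n; apply: cF => A xA.
by apply: xcl xA; exists n => // m /= nm; apply: (Fle n m nm); exact: uP.
Qed.

Lemma compact_hausdorff_homeo (T U : topologicalType) (h : T -> U) :
  compact [set: T] -> hausdorff_space U -> continuous h -> injective h ->
  (forall u, exists t, h t = u) -> homeomorphism h.
Proof.
move=> cT hU ch hinj hsurj; split => //.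
have [k hk] := choice hsurj; exists k; split=> [t|//|].
  by apply: hinj; rewrite hk.
apply/continuousP => A oA; rewrite -[_ @^-1` _]setCK; apply: closed_openC.
have -> : ~` (k @^-1` A) = h @` (~` A).
  apply/seteqP; split=> [u nu|_ [t nt <-]] /=; first by exists (k u).
  by have -> : k (h t) = t by apply: hinj; rewrite hk.
apply: compact_closed => //; apply: continuous_compact.
  by apply: continuous_subspaceT.
by apply: (subclosed_compact _ cT) => //; exact: open_closedC.
Qed.

Lemma hausdorff_set_type (U : topologicalType) (A : set U) :
  hausdorff_space U -> hausdorff_space A.
Proof.
move=> hU x y xy; apply: val_inj; apply: hU => P Q Px Qy.
have [z [Pz Qz]] := xy _ _ (@initial_continuous A U val x P Px)
  (@initial_continuous A U val y Q Qy).
by exists (val z).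
Qed.

Section Towers.
Variables (T : topologicalType) (f g : T -> T) (L : choiceType).
Variables (Bs : nat -> set T) (lab : nat -> T -> L) (ht : nat -> L -> nat).
Variable Lab : nat -> seq L.
Hypotheses (fK : cancel f g) (gK : cancel g f).
Hypothesis g_cont : continuous g.
Hypothesis T_compact : compact [set: T].
Hypothesis T_nonempty : [set: T] !=set0.
Hypothesis Lab_uniq : forall n, uniq (Lab n).
Hypothesis mem_Lab : forall n l, l \in Lab n <-> exists2 y, Bs n y & lab n y = l.
Hypothesis Lab0 : size (Lab 0) = 1%N.
Hypothesis Bs0 : forall x, Bs 0%N x.
Hypothesis BsS : forall n, Bs n.+1 `<=` Bs n.
Hypothesis ht_gt0 : forall n x, Bs n x -> (0 < ht n (lab n x))%N.
Hypothesis Bs_ht : forall n x, Bs n x -> Bs n (iter (ht n (lab n x)) f x).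
Hypothesis Bs_lt_ht : forall n x i, Bs n x -> (0 < i < ht n (lab n x))%N ->
  ~ Bs n (iter i f x).
Hypothesis refines : forall n x y i, Bs n.+1 x -> Bs n.+1 y ->
  lab n.+1 x = lab n.+1 y -> (i < ht n.+1 (lab n.+1 x))%N ->
  Bs n (iter i f x) ->
  Bs n (iter i f y) /\ lab n (iter i f x) = lab n (iter i f y).
Hypothesis visits : forall n x, exists i, Bs n (iter i g x).
Hypothesis lab_near : forall n x, Bs n x ->
  \forall z \near x, Bs n z /\ lab n z = lab n x.
Hypothesis separates : forall x y, (forall n, exists x' y' i,
  [/\ Bs n.+1 x', Bs n.+1 y', lab n.+1 x' = lab n.+1 y',
      (i < ht n.+1 (lab n.+1 x'))%N & x = iter i f x' /\ y = iter i f y']) ->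
  x = y.
Hypothesis bases_meet : forall x y, (forall n, Bs n x) -> (forall n, Bs n y) ->
  x = y.

(** * Position of a point in a tower partition *)

Lemma iter_fK i x : iter i g (iter i f x) = x.
Proof. by elim: i x => // i IH x; rewrite iterSr iterS fK IH. Qed.

Lemma iter_gK i x : iter i f (iter i g x) = x.
Proof. by elim: i x => // i IH x; rewrite iterSr iterS gK IH. Qed.

Lemma iter_fKsub i j x : (j <= i)%N -> iter j g (iter i f x) = iter (i - j) f x.
Proof. by move=> ji; rewrite -{1}(subnKC ji) iterD iter_fK. Qed.

Lemma iter_gKsub i j x : (j <= i)%N -> iter (i - j) f (iter i g x) = iter j g x.
Proof. by move=> ji; rewrite -{2}(subnK ji) iterD iter_gK. Qed.

Lemma ht_le n x k : Bs n x -> (0 < k)%N -> Bs n (iter k f x) ->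
  (ht n (lab n x) <= k)%N.
Proof.
move=> nx k0 nk; rewrite leqNgt; apply/negP => kh.
by apply: (Bs_lt_ht nx (i := k)) => //; rewrite k0.
Qed.

Lemma visits_bool n x : exists i, `[< Bs n (iter i g x) >].
Proof. by have [i ?] := visits n x; exists i; apply/asboolP. Qed.

(** The level of [x] in its tower of stage [n], that is, the time elapsed since the last visit to
    [Bs n]; [root] is the point of that visit. *)
Definition age n x : nat := ex_minn (visits_bool n x).
Definition root n x : T := iter (age n x) g x.

Lemma root_base n x : Bs n (root n x).
Proof. by rewrite /root /age; case: ex_minnP => i /asboolP. Qed.

Lemma age_min n x i : Bs n (iter i g x) -> (age n x <= i)%N.
Proof. by move=> ni; rewrite /age; case: ex_minnP => j _; apply; apply/asboolP. Qed.

Lemma iter_root n x : iter (age n x) f (root n x) = x.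
Proof. exact: iter_gK. Qed.

(** Otherwise the first return of the root to the base would be a visit more recent than the
    root. *)
Lemma age_lt n x : (age n x < ht n (lab n (root n x)))%N.
Proof.
rewrite ltnNge; apply/negP => h; have rb := root_base n x.
have := Bs_ht rb; rewrite {2}/root -(subKn h) iter_gKsub ?leq_subr //.
by move/age_min; have := ht_gt0 rb; lia.
Qed.

Lemma age_iter n y i : Bs n y -> (i < ht n (lab n y))%N ->
  age n (iter i f y) = i /\ root n (iter i f y) = y.
Proof.
move=> ny ih; have le : (age n (iter i f y) <= i)%N.
  by apply: age_min; rewrite iter_fK.
have e : age n (iter i f y) = i.
  apply/eqP; rewrite eqn_leq le leqNgt; apply/negP => lt.
  have := root_base n (iter i f y); rewrite /root iter_fKsub //.
  by apply: Bs_lt_ht => //; lia.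
by split => //; rewrite /root e iter_fK.
Qed.

Lemma age_base n x : Bs n x -> age n x = 0%N /\ root n x = x.
Proof. by move=> nx; apply: (@age_iter n x 0%N) => //; exact: ht_gt0. Qed.

Lemma age0 x : age 0 x = 0%N.
Proof. by have [] := age_base (Bs0 x). Qed.

Lemma leq_age n x : (age n x <= age n.+1 x)%N.
Proof. by apply: age_min; apply: BsS; exact: root_base. Qed.

Lemma age_succ n x : ~ Bs n (f x) ->
  age n (f x) = (age n x).+1 /\ root n (f x) = root n x.
Proof.
move=> nfx; rewrite -{1 3}(iter_root n x) -iterS; apply: age_iter.
  exact: root_base.
rewrite ltn_neqAle age_lt andbT; apply/eqP => e; apply: nfx.
by rewrite -(iter_root n x) -iterS e; exact/Bs_ht/root_base.
Qed.

Lemma label_in n x : lab n (root n x) \in Lab n.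
Proof. by apply/mem_Lab; exists (root n x) => //; exact: root_base. Qed.

(** * Towers as vertices, visited levels as edges *)

Definition vertex n : finType := seq_sub (Lab n).
Definition tower n x : vertex n := SeqSub (label_in n x).

Lemma towerP n x y : lab n (root n x) = lab n (root n y) <-> tower n x = tower n y.
Proof. by split=> [e|/(congr1 (@ssval _ _))//]; apply: val_inj. Qed.

Lemma rep_exists n (v : vertex n) : exists y, Bs n y /\ lab n y = ssval v.
Proof. by have /mem_Lab[y] := ssvalP v; exists y. Qed.

(** An arbitrary base point of the tower; by [refines], which levels are visits to the previous
    base, and with which label, does not depend on this choice. *)
Definition rep n (v : vertex n) : T := projT1 (cid (rep_exists v)).

Lemma repP n (v : vertex n) : Bs n (rep v) /\ lab n (rep v) = ssval v.
Proof. by rewrite /rep; case: cid. Qed.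

Lemma tower_rep n (v : vertex n) : tower n (rep v) = v.
Proof.
have [Bv lv] := repP v; apply: val_inj => /=.
by have [_ ->] := age_base Bv.
Qed.

Definition max_ht n := (\max_(l <- Lab n) ht n l)%N.

Lemma ht_max n x : (ht n (lab n (root n x)) <= max_ht n)%N.
Proof. exact: (@leq_bigmax_seq _ (Lab n) xpredT (ht n) _ (label_in n x)). Qed.

(* An edge (w, i) into the tower w records that level i of w lies in [Bs n]; its
   source is the tower of stage n with base containing that level. *)
Definition is_level n (e : vertex n.+1 * 'I_(max_ht n.+1).+1) : bool :=
  (e.2 < ht n.+1 (ssval e.1))%N && `[< Bs n (iter e.2 f (rep e.1)) >].

Definition tower_edge n : finType := {e | @is_level n e}.

Lemma is_levelP n y i : Bs n.+1 y -> (i < ht n.+1 (lab n.+1 y))%N ->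
  Bs n (iter i f y) -> @is_level n (tower n.+1 y, inord i).
Proof.
move=> ny ih nfi; have [_ ry] := age_base ny.
have := ht_max n.+1 y; rewrite ry => hm.
have [Br lr] := repP (tower n.+1 y); rewrite /= ry in lr.
rewrite /is_level /= inordK; last by lia.
rewrite ry ih; apply/asboolP.
by have [] := refines ny Br (esym lr) ih nfi.
Qed.

Lemma level_sub n (x : T) : let i := (age n.+1 x - age n x)%N in
  [/\ (i < ht n.+1 (lab n.+1 (root n.+1 x)))%N,
      iter i f (root n.+1 x) = root n x & Bs n (iter i f (root n.+1 x))].
Proof.
have e : iter (age n.+1 x - age n x) f (root n.+1 x) = root n x.
  by rewrite /root iter_gKsub // leq_age.
split => //; last by rewrite e; exact: root_base.
by apply: leq_ltn_trans (age_lt n.+1 x); exact: leq_subr.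
Qed.

Lemma edge_of_proof n x :
  @is_level n (tower n.+1 x, inord (age n.+1 x - age n x)).
Proof.
have [h _ b] := level_sub n x; have rb := root_base n.+1 x.
have := is_levelP rb h b; congr (is_level (_, _)); apply: val_inj => /=.
by have [_ ->] := age_base rb.
Qed.

(** The edge that records which level of the tower of stage [n.+1] contains [root n x]. *)
Definition edge_of n x : tower_edge n :=
  exist (fun e => is_true (@is_level n e)) _ (edge_of_proof n x).

Definition edge_height n (e : tower_edge n) : nat := (val e).2.

Lemma edge_height_of n x : edge_height (edge_of n x) = (age n.+1 x - age n x)%N.
Proof.
rewrite /edge_height /= inordK //.
by have [h _ _] := level_sub n x; have := ht_max n.+1 x; lia.
Qed.

Definition edge_range n (e : tower_edge n) : vertex n.+1 := (val e).1.
Definition edge_source n (e : tower_edge n) : vertex n :=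
  tower n (iter (edge_height e) f (rep (edge_range e))).

Lemma tower_edge_eq n (e e' : tower_edge n) : edge_range e = edge_range e' ->
  edge_height e = edge_height e' -> e = e'.
Proof.
move=> h1 h2; apply: val_inj; move: h1 h2; rewrite /edge_range /edge_height.
by case: (val e) (val e') => a b [c d] /= -> /val_inj ->.
Qed.

(** Edges are defined through representatives; [refines] transports level and label to every base
    point of the same tower. *)
Lemma edge_level n (e : tower_edge n) y : Bs n.+1 y ->
  lab n.+1 y = ssval (edge_range e) ->
  [/\ (edge_height e < ht n.+1 (lab n.+1 y))%N, Bs n (iter (edge_height e) f y) &
      lab n (iter (edge_height e) f y) = ssval (edge_source e)].
Proof.
move=> ny ly; have := valP e; rewrite /is_level -/(edge_height e) -/(edge_range e).
move=> /andP[h /asboolP b]; have [rb rl] := repP (edge_range e).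
have := refines rb ny _ _ b; rewrite rl ly => /(_ erefl h) [b' l'].
by split => //=; have [_ ->] := age_base b.
Qed.

Lemma edge_of_source n x : edge_source (edge_of n x) = tower n x.
Proof.
have [h e b] := level_sub n x.
have [_ b' l'] := @edge_level n (edge_of n x) _ (root_base n.+1 x) erefl.
apply: val_inj.
by rewrite -[LHS]/(ssval _) -l' edge_height_of e.
Qed.

Definition edge_le n : rel (tower_edge n) :=
  fun e e' => (edge_range e == edge_range e') && (edge_height e <= edge_height e')%N.

Lemma vertex_gt0 n : (0 < #|vertex n|)%N.
Proof. by have [x _] := T_nonempty; apply/card_gt0P; exists (tower n x). Qed.

Lemma tower_edge_gt0 n : (0 < #|tower_edge n|)%N.
Proof. by have [x _] := T_nonempty; apply/card_gt0P; exists (edge_of n x). Qed.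

Lemma edge_source_surj n (v : vertex n) : exists e : tower_edge n, edge_source e = v.
Proof. by exists (edge_of n (rep v)); rewrite edge_of_source tower_rep. Qed.

Lemma edge_range_surj n (v : vertex n.+1) :
  exists e : tower_edge n, edge_range e = v.
Proof. by exists (edge_of n (rep v)); exact: tower_rep. Qed.

Lemma vertex0 : #|vertex 0| = 1%N.
Proof. by rewrite card_seq_sub. Qed.

Lemma edge_le_refl n : reflexive (@edge_le n).
Proof. by move=> e; rewrite /edge_le eqxx leqnn. Qed.

Lemma edge_le_anti n : antisymmetric (@edge_le n).
Proof.
move=> e e' /andP[/andP[/eqP h1 h2] /andP[_ h3]].
by apply: tower_edge_eq => //; apply/eqP; rewrite eqn_leq h2.
Qed.

Lemma edge_le_trans n : transitive (@edge_le n).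
Proof.
move=> e e' e'' /andP[/eqP r h] /andP[r' h'].
by rewrite /edge_le r r' (leq_trans h h').
Qed.

Lemma edge_le_comparable n (e e' : tower_edge n) :
  edge_le e e' || edge_le e' e = (edge_range e == edge_range e').
Proof.
rewrite /edge_le [edge_range e' == _]eq_sym -andb_orr.
by case: (leqP (edge_height e)) => /= [_|/ltnW ->]; rewrite ?andbT ?orbT ?andbT.
Qed.

Definition tower_diagram : ordered_bratteli :=
  OrderedBratteli vertex0 vertex_gt0 tower_edge_gt0 edge_source_surj
    edge_range_surj edge_le_refl edge_le_anti edge_le_trans edge_le_comparable.

Local Notation B := tower_diagram.

(** * The itinerary homeomorphism *)

Definition itinerary_seq (x : T) : edge_sequences B := fun n => edge_of n x.

Lemma itinerary_path x : itinerary_seq x \in @path_set B.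
Proof. by apply/mem_set => n /=; rewrite edge_of_source. Qed.

Definition itinerary (x : T) : path_space B :=
  exist (fun p => is_true (p \in @path_set B)) _ (itinerary_path x).

(** Ages telescope: they start at 0, and the edge heights are their successive differences. *)
Lemma itinerary_age x y : (forall n, path_edge (itinerary x) n = path_edge (itinerary y) n) ->
  forall n, age n x = age n y.
Proof.
move=> e; elim=> [|n IH]; first by rewrite !age0.
have := congr1 (@edge_height n) (e n); rewrite !edge_height_of.
by have := leq_age n x; have := leq_age n y; lia.
Qed.

Lemma itinerary_inj : injective itinerary.
Proof.
move=> x y xy; have e n : path_edge (itinerary x) n = path_edge (itinerary y) n by rewrite xy.
apply: separates => n; exists (root n.+1 x), (root n.+1 y), (age n.+1 x).
split; try exact: root_base; last 2 first.
- exact: age_lt.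
- by split; [rewrite iter_root|rewrite (itinerary_age e) iter_root].
exact/towerP/(congr1 (@edge_range n) (e n)).
Qed.

(** Going back [age n x] steps from a nearby point leads to a base point with the label of the root,
    and then [age_iter] forces age and root. *)
Lemma tower_near n x :
  \forall z \near x, age n z = age n x /\ tower n z = tower n x.
Proof.
have c k : continuous (iter k g).
  elim: k => [|k IH] z; first exact: cvg_id.
  exact: (continuous_comp (@IH z) (@g_cont (iter k g z))).
have near_root : nbhs x [set z | Bs n (iter (age n x) g z) /\
    lab n (iter (age n x) g z) = lab n (root n x)].
  exact: (@c (age n x) x _ (lab_near (root_base n x))).
apply: filterS near_root => z [/= zb zl].
have := age_iter zb; rewrite zl => /(_ _ (age_lt n x)); rewrite iter_gK => -[az rz].
by split => //; apply/towerP; rewrite rz zl.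
Qed.

Lemma edge_near n x : \forall z \near x, edge_of n z = edge_of n x.
Proof.
apply: filterS2 (tower_near n x) (tower_near n.+1 x) => z [a1 _] [a2 t2].
by apply: tower_edge_eq => //; rewrite !edge_height_of a1 a2.
Qed.

Lemma atom_closed n a (v : vertex n) : closed [set x | age n x = a /\ tower n x = v].
Proof.
by move=> x /(_ _ (tower_near n x)) [z [[<- <-] [-> ->]]].
Qed.

(** The partial sums [A n] of the edge heights prescribe the age at each stage. The atoms with these
    ages in the towers of the path are nonempty, closed and nested, so compactness yields a
    point. *)
Lemma itinerary_surj (p : path_space B) : exists x, itinerary x = p.
Proof.
pose e n : tower_edge n := path_edge p n.
have src n : edge_source (e n.+1) = edge_range (e n).
  by apply: esym; exact: (set_mem (valP p) n).
pose A n := (\sum_(k < n) edge_height (e k))%N.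
have AS n : A n.+1 = (A n + edge_height (e n))%N by rewrite /A big_ord_recr.
(* A return to [Bs n.+1] is also a visit to [Bs n], so the whole source tower fits in above the
   level [edge_height (e n)]. *)
have step n y : Bs n.+1 y -> lab n.+1 y = ssval (edge_range (e n)) ->
    (A n < ht n (ssval (edge_source (e n))))%N ->
    (A n.+1 < ht n.+1 (lab n.+1 y))%N.
  move=> ny ly Ah; have [h b l] := edge_level ny ly.
  have k0 : (0 < ht n.+1 (lab n.+1 y) - edge_height (e n))%N by rewrite subn_gt0.
  have := BsS (Bs_ht ny); rewrite -{1}(subnK (ltnW h)) iterD.
  by move=> /(ht_le b k0); rewrite l AS; lia.
have Aht n : (A n < ht n (ssval (edge_source (e n))))%N.
  elim: n => [|n IH].
    by rewrite /A big_ord0; have [rb <-] := repP (edge_source (e 0)); exact: ht_gt0.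
  rewrite src; have [rb rl] := repP (edge_range (e n)).
  by rewrite -rl; exact: step.
pose F n := [set x | age n x = A n /\ tower n x = edge_source (e n)].
have [x xF] : exists x, forall n, F n x.
  apply: nested_closed_nonempty => // [n|n|n x [xa xt]].
  - exact: atom_closed.
  - have [rb rl] := repP (edge_source (e n)).
    exists (iter (A n) f (rep (edge_source (e n)))).
    have := age_iter rb; rewrite rl => /(_ _ (Aht n)) [xa xr]; split => //.
    by apply: val_inj; rewrite /= xr rl.
  - have rb := root_base n.+1 x.
    have rl : lab n.+1 (root n.+1 x) = ssval (edge_range (e n)).
      by rewrite -src -xt.
    have [h b l] := edge_level rb rl.
    have := age_iter b; rewrite l => /(_ _ (Aht n)).
    rewrite -iterD -AS -xa iter_root => -[xa' xr]; split => //.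
    by apply: val_inj; rewrite /= xr l.
exists x; apply: val_inj; apply: functional_extensionality_dep => n.
apply: (@tower_edge_eq n (edge_of n x) (e n)).
  by rewrite -src; case: (xF n.+1).
have [xa _] := xF n; have [xaS _] := xF n.+1.
by rewrite edge_height_of xa xaS AS addKn.
Qed.

Lemma itinerary_continuous : continuous itinerary.
Proof.
apply: (@continuous_comp_initial _ _ _ val) => x; apply/cvg_sup => n U [V [[W oW <-] Wx WU]].
apply: filterS (edge_near n x) => z zx; apply: WU.
by rewrite /= /itinerary_seq zx.
Qed.

Lemma itinerary_homeo : homeomorphism itinerary.
Proof.
apply: compact_hausdorff_homeo => //.
- apply: hausdorff_set_type; apply: hausdorff_product => n.
  exact: discrete_hausdorff.
- exact: itinerary_continuous.
- exact: itinerary_inj.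
- exact: itinerary_surj.
Qed.

(** * Extremal edges and the Vershik map *)

Lemma edge_height_le n x (e : tower_edge n) : edge_range e = tower n.+1 x ->
  (edge_height e <= age n.+1 x)%N -> (edge_height e <= edge_height (edge_of n x))%N.
Proof.
move=> er h; have [_ b _] := edge_level (root_base n.+1 x) (esym (congr1 (@ssval _ _) er)).
(* A visit to [Bs n] at a level not above [x] is no more recent than [root n x]. *)
suff : (age n x <= age n.+1 x - edge_height e)%N by rewrite edge_height_of; lia.
apply: age_min; move: b; congr (Bs n _).
by rewrite -[in LHS](subKn h) /root iter_gKsub ?leq_subr.
Qed.

Lemma edge_of_max n x : Bs n.+1 (f x) -> @edge_max B n (edge_of n x).
Proof.
move=> nfx; apply/forallP => e; apply/implyP => /andP[/eqP er eh].
apply/eqP; apply: tower_edge_eq; first exact: esym.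
apply/eqP; rewrite eqn_leq eh andbT; apply: edge_height_le; first exact: esym.
have [h _ _] := edge_level (root_base n.+1 x) (congr1 (@ssval _ _) er).
rewrite -ltnS; apply: leq_trans h _; apply: ht_le => //; first exact: root_base.
by rewrite iterS iter_root.
Qed.

(** Here [f x] sits one level above [x] in the same tower of stage [n.+1] and starts a new tower of
    stage [n]; by [edge_height_le] no visited level lies strictly between the two edges. *)
Lemma edge_of_not_max n x : Bs n (f x) -> ~ Bs n.+1 (f x) ->
  @edge_succ B n (edge_of n x) (edge_of n (f x)).
Proof.
move=> nfx nfxS; have [a r] := age_succ nfxS; have [a0 _] := age_base nfx.
have t : tower n.+1 (f x) = tower n.+1 x by apply/towerP; rewrite r.
have h : edge_height (edge_of n (f x)) = (age n.+1 x).+1.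
  by rewrite edge_height_of a a0 subn0.
have hlt : (edge_height (edge_of n x) < edge_height (edge_of n (f x)))%N.
  by rewrite h ltnS edge_height_of leq_subr.
apply/and3P; split.
- by apply/eqP => e; move: hlt; rewrite e ltnn.
- by apply/andP; split; [apply/eqP | exact: ltnW].
- apply/forallP => e; apply/implyP => /andP[/andP[/eqP er eh] /andP[_ eh']].
  move: eh'; rewrite leq_eqVlt => /orP[/eqP eh'|].
    by apply/orP; right; apply/eqP; apply: tower_edge_eq => //; rewrite -er; exact: esym t.
  rewrite h ltnS => /edge_height_le eh'; apply/orP; left; apply/eqP.
  apply: tower_edge_eq; first exact: esym.
  by apply/eqP; rewrite eqn_leq eh andbT eh' // -er.
Qed.

Lemma edge_succ_not_max n (e e' : bedge B n) : edge_succ e e' -> ~~ edge_max e.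
Proof.
move=> /and3P[ne le _]; apply/negP => /forallP /(_ e') /implyP /(_ le) /eqP ee.
by rewrite ee eqxx in ne.
Qed.

Lemma edge_max_base n x : Bs n (f x) -> @edge_max B n (edge_of n x) -> Bs n.+1 (f x).
Proof.
move=> nfx mx; apply: contrapT => nfxS.
by have := edge_succ_not_max (edge_of_not_max nfx nfxS); rewrite mx.
Qed.

Lemma edge_max_lt k x : (forall j, (j < k)%N -> @edge_max B j (edge_of j x)) ->
  Bs k (f x).
Proof.
elim: k => [|k IH] h; first exact: Bs0.
by apply: edge_max_base; [apply: IH => j jk; apply: h; exact: ltnW|exact: h].
Qed.

Lemma Bs_le m n : (m <= n)%N -> Bs n `<=` Bs m.
Proof.
by move=> /subnK <-; elim: (n - m)%N => {n} // k IH x /BsS /IH.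
Qed.

Lemma edge_of_min n x : Bs n.+1 x -> @edge_min B n (edge_of n x).
Proof.
move=> nx; have [a _] := age_base nx.
have h : edge_height (edge_of n x) = 0%N by rewrite edge_height_of a sub0n.
apply/forallP => e; apply/implyP => /andP[/eqP er]; rewrite h leqn0 => /eqP eh.
by apply/eqP; apply: tower_edge_eq => //; rewrite eh h.
Qed.

Lemma edge_min_base n x : Bs n x -> @edge_min B n (edge_of n x) -> Bs n.+1 x.
Proof.
move=> nx /forallP /(_ (edge_of n (root n.+1 x))).
have [a0 r0] := age_base (root_base n.+1 x).
have rng : edge_range (edge_of n (root n.+1 x)) = edge_range (edge_of n x).
  by apply/towerP; rewrite r0.
have h : edge_height (edge_of n (root n.+1 x)) = 0%N by rewrite edge_height_of a0 sub0n.
move=> /implyP; rewrite /= /edge_le rng eqxx h => /(_ isT) /eqP e.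
have := edge_height_of n x; rewrite -e h; have [-> _] := age_base nx.
rewrite subn0 => /esym a1; have := root_base n.+1 x; by rewrite /root a1.
Qed.

Lemma itinerary_min x : path_min (itinerary x) <-> forall n, Bs n x.
Proof.
split=> [m|h n]; last exact: edge_of_min.
by elim=> [|n IH]; [exact: Bs0 | exact: edge_min_base (m n)].
Qed.

Lemma itinerary_max x : path_max (itinerary x) <-> forall n, Bs n (f x).
Proof.
split=> [m n|h n]; last exact: edge_of_max.
by apply: edge_max_lt => j _; exact: m.
Qed.

Lemma tower_essentially_simple : essentially_simple B.
Proof.
have [x xB] : exists x, forall n, Bs n x.
  (* The bases are closed: their points are those of age 0, and the age is locally constant. *)
  apply: nested_closed_nonempty => // [n z zB|n].
    have [w [wB [wa _]]] := zB _ (tower_near n z).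
    have [a0 _] := age_base wB; have := root_base n z.
    by rewrite /root -wa a0.
  by have [z _] := T_nonempty; exists (root n z); exact: root_base.
split.
  exists (itinerary (g x)); split; first by apply/itinerary_max => n; rewrite gK.
  move=> p; have [y <-] := itinerary_surj p => /itinerary_max yB.
  by congr itinerary; rewrite -(fK y); congr g; exact: bases_meet.
exists (itinerary x); split; first exact/itinerary_min.
move=> p; have [y <-] := itinerary_surj p => /itinerary_min yB.
by congr itinerary; exact: bases_meet.
Qed.

(** If [k] is the first stage with a nonmaximal edge, then [f x] lies in [Bs k] but not in
    [Bs k.+1]. Below [k] the edges of [f x] are minimal; above [k] both ages grow by one, so their
    difference, the edge height, is unchanged. *)
Lemma itinerary_vershik_rel x : vershik_rel (itinerary x) (itinerary (f x)).
Proof.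
have [m|/existsNP[k0 /negP k0P]] := pselect (path_max (itinerary x)).
  by left; split => //; apply/itinerary_min/itinerary_max.
right; case: (ex_minnP (ex_intro (fun k => ~~ edge_max (path_edge (itinerary x) k)) k0 k0P)).
move=> k kP kmin; exists k.
have mlt j : (j < k)%N -> @edge_max B j (edge_of j x).
  by rewrite ltnNge; apply: contraNT => /kmin.
have kB := edge_max_lt mlt.
have kSB : ~ Bs k.+1 (f x) by move=> h; move/negP: kP; apply; exact: edge_of_max.
split => //; first exact: edge_of_not_max.
  by move=> j jk; apply: edge_of_min; exact: Bs_le kB.
move=> j kj; have nB i : (k < i)%N -> ~ Bs i (f x).
  by move=> ki h; apply: kSB; exact: Bs_le h.
have [a1 r1] := age_succ (nB j kj); have [a2 r2] := age_succ (nB j.+1 (ltnW kj)).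
apply: tower_edge_eq; first by apply/towerP; rewrite r2.
by rewrite !edge_height_of a1 a2 subSS.
Qed.

Lemma tower_conjugate : conjugate f (@vershik B).
Proof.
exists itinerary; split=> [|x]; first exact: itinerary_homeo.
apply: (@vershik_rel_inj B (itinerary x)).
- exact: tower_essentially_simple.
- exact: itinerary_vershik_rel.
- exact/vershikP/tower_essentially_simple.
Qed.

Lemma card_tower_vertex n : #|bvertex B n| = size (Lab n).
Proof. exact: card_seq_sub. Qed.

End Towers.

Local Open Scope ring_scope.

(** * Words and windows *)

Definition win (x : int -> bool) (p : int) (n : nat) : word :=
  mkseq (fun i => x (p + i%:Z)) n.

Lemma size_win x p n : size (win x p n) = n.
Proof. exact: size_mkseq. Qed.

Lemma nth_win x p n i : (i < n)%N -> nth false (win x p n) i = x (p + i%:Z).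
Proof. exact: nth_mkseq. Qed.

Lemma eq_win x y p q n :
  (forall i : nat, (i < n)%N -> x (p + i%:Z) = y (q + i%:Z)) ->
  win x p n = win y q n.
Proof.
move=> xy; apply: (@eq_from_nth _ false); rewrite !size_win // => i ilt.
by rewrite !nth_win // xy.
Qed.

Lemma win_inj x y p q n : win x p n = win y q n ->
  forall i : nat, (i < n)%N -> x (p + i%:Z) = y (q + i%:Z).
Proof. by move=> e i ilt; rewrite -(nth_win x p ilt) e nth_win. Qed.

Lemma win_at x y p q n (a : int) : win x p n = win y q n ->
  p <= a -> a < p + n%:Z -> x a = y (a - p + q).
Proof.
move=> e pa an; have lt : (`|(a - p)%R| < n)%N by lia.
have := win_inj e lt.
have -> : p + `|(a - p)%R|%N = a by lia.
by move=> ->; congr (y _); lia.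
Qed.

Lemma win_cat x p m n : win x p (m + n) = win x p m ++ win x (p + m%:Z) n.
Proof.
apply: (@eq_from_nth _ false); rewrite ?size_cat !size_win // => i ilt.
rewrite nth_cat size_win; case: ltnP => im; first by rewrite !nth_win //; lia.
by rewrite !nth_win; [congr (x _); lia| lia | lia].
Qed.

Lemma win_sub x y p q n m k : win x p n = win y q n -> (k + m <= n)%N ->
  win x (p + k%:Z) m = win y (q + k%:Z) m.
Proof.
move=> e kmn; apply: eq_win => i im.
have lt : (k + i < n)%N by lia.
have := win_inj e lt; by rewrite PoszD !addrA.
Qed.

Lemma win_shift k x p n : win (shift_by k x) p n = win x (p + k) n.
Proof. by apply: eq_win => i _; rewrite /shift_by; congr (x _); lia. Qed.

Lemma win_drop x p n k : (k <= n)%N ->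
  drop k (win x p n) = win x (p + k%:Z) (n - k).
Proof.
move=> kn; apply: (@eq_from_nth _ false); rewrite ?size_drop !size_win // => i il.
by rewrite nth_drop !nth_win; [congr (x _); lia | lia | lia].
Qed.

Lemma win_take x p n k : (k <= n)%N -> take k (win x p n) = win x p k.
Proof.
move=> kn; apply: (@eq_from_nth _ false).
  by rewrite size_takel !size_win.
rewrite size_takel ?size_win // => i il.
by rewrite nth_take // !nth_win //; exact: leq_trans kn.
Qed.

Lemma shift_byD a b x : shift_by a (shift_by b x) = shift_by (a + b) x.
Proof. by apply/funext => n; rewrite /shift_by; congr (x _); lia. Qed.

Lemma shift_by0 x : shift_by 0 x = x.
Proof. by apply/funext => n; rewrite /shift_by addr0. Qed.

(** * Central cylinders *)

Definition agree (N : nat) (x y : int -> bool) : Prop :=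
  forall i : int, (`|i|%N <= N)%N -> x i = y i.

Lemma agree_sym N x y : agree N x y -> agree N y x.
Proof. by move=> h i iN; rewrite h. Qed.

Lemma agree_trans N x y z : agree N x y -> agree N y z -> agree N x z.
Proof. by move=> h h' i iN; rewrite h // h'. Qed.

Lemma agree_le M N x y : (M <= N)%N -> agree N x y -> agree M x y.
Proof. by move=> MN h i iN; apply: h; lia. Qed.

Lemma agree_win N x y p n : agree N x y ->
  - N%:Z <= p -> p + n%:Z <= N%:Z + 1 -> win x p n = win y p n.
Proof. by move=> h pN nN; apply: eq_win => i il; apply: h; lia. Qed.

Lemma win_agree N x y :
  win x (- N%:Z) (N + N).+1 = win y (- N%:Z) (N + N).+1 -> agree N x y.
Proof.
move=> e i iN; rewrite (win_at e (a := i)); [|lia|lia].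
by congr (y _); lia.
Qed.

Lemma agree_eq x y : (forall N, agree N x y) -> x = y.
Proof. by move=> h; apply/funext => i; apply: (h `|i|%N). Qed.

Lemma coord_near (x : full_shift) (i : int) : \forall y \near x, y i = x i.
Proof.
have c := @proj_continuous int (fun _ => bool) i x.
by apply: (c [set x i]); exact: discrete_set1.
Qed.

Lemma agree_near (x : full_shift) N : nbhs x [set y | agree N x y].
Proof.
pose P (i : 'I_(N + N).+1) := [set y : full_shift | y (i%:Z - N%:Z) = x (i%:Z - N%:Z)].
have : nbhs x [set y | forall i, P i y].
  by apply: (@filter_forall _ _ P (nbhs x)) => i; exact: coord_near.
apply: filterS => y h i iN.
have lt : (`|(i + N%:Z)%R|%N < (N + N).+1)%N by lia.
have := h (Ordinal lt) => /=.
by rewrite /P /=; have -> : `|(i + N%:Z)%R|%N%:Z - N%:Z = i by lia.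
Qed.

(** The product topology is a supremum of pullbacks, so the filter of central cylinders need only be
    compared with it one coordinate at a time. *)
Lemma nbhs_agree (x : full_shift) (A : set full_shift) :
  nbhs x A -> exists N, [set y | agree N x y] `<=` A.
Proof.
pose F : set_system full_shift := filter_from [set: nat] (fun N => [set y | agree N x y]).
have FF : Filter F.
  apply: filter_from_filter; first by exists 0%N.
  move=> M N _ _; exists (maxn M N) => // y h.
  by split; apply: agree_le h; rewrite ?leq_maxl ?leq_maxr.
suff : F --> x by move=> Fx /Fx [N _ NA]; exists N.
apply/cvg_sup => i U [V [[W oW <-] Wx WU]].
by exists `|i|%N => // y h; apply: WU; rewrite /= -(h i).
Qed.

(** * Minimal subshifts *)

Lemma full_shift_compact : compact [set: full_shift].
Proof.
have := @tychonoff int (fun _ => bool) _ (fun=> bool_compact).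
by congr (compact _); rewrite eqEsubset.
Qed.

Lemma subshift_compact (X : subshift) : compact (X : set full_shift).
Proof.
apply: (subclosed_compact _ full_shift_compact) => //.
exact: subshift_closed.
Qed.

Lemma subshift_sigmaP (X : subshift) (x : full_shift) :
  (X : set _) (sigma x) <-> (X : set _) x.
Proof.
split=> [|Xx]; last by rewrite -(subshift_sigma X); exists x.
rewrite -{1}(subshift_sigma X) => -[y Xy yx].
suff <- : y = x by [].
apply/funext => n; have := congr1 (fun z : full_shift => z (n - 1)) yx.
by rewrite /sigma /shift_by subrK.
Qed.

Lemma subshift_shift (X : subshift) (k : int) (x : full_shift) :
  (X : set _) x -> (X : set _) (shift_by k x).
Proof.
move=> Xx; elim: k => [|n IH|n IH]; first by rewrite shift_by0.
  by rewrite intS -shift_byD subshift_sigmaP.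
rewrite -subshift_sigmaP /sigma shift_byD.
by have -> : 1 + - n.+1%:Z = - n%:Z by lia.
Qed.

Section MinimalSubshift.
Variable X : subshift.
Hypothesis Xinf : infinite_set (subshift_set X).
Hypothesis Xmin : minimal_subshift X.

Lemma minimal_nonempty : exists x, subshift_set X x.
Proof. exact: infinite_setN0. Qed.

(** By compactness a single [K] bounds, for all points of [X], the distance from 0 to an occurrence
    of the window. Applying this at [a + K] makes the occurrence fall to the right of [a]. *)
Lemma minimal_syndetic y p n : subshift_set X y ->
  exists G : nat, forall x (a : int), subshift_set X x ->
    exists2 i : nat, (i < G)%N & win x (a + i%:Z) n = win y p n.
Proof.
move=> Xy.
pose P (K : nat) (x : full_shift) :=
  exists2 k : int, (`|k|%N <= K)%N & win x k n = win y p n.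
have /compact_near_coveringP/(_ nat \oo P _) := @subshift_compact X.
case=> [x Xx|K _ KP].
  pose U := [set z : full_shift | agree (`|p|%N + n) (shift_by 0 y) z].
  have [z [[k _ <-] /= zy]] := Xmin Xx (Xy) (agree_near y (`|p|%N + n)).
  exists ([set z : full_shift | agree (`|(p + k)%R|%N + n) x z], [set K | `|(p + k)%R| <= K]%N).
    split; first exact: agree_near.
    by exists `|(p + k)%R|%N.
  move=> [w K] /= [xw kK]; exists (p + k) => //.
  rewrite -(agree_win xw); [|lia|lia].
  by rewrite -win_shift; apply: esym; apply: agree_win zy _ _; lia.
exists (K + K).+1 => x a Xx.
have /(KP K (leqnn K)) [k kK e] := subshift_shift (a + K%:Z) Xx.
exists `|(k + K%:Z)%R|%N; first by lia.
by rewrite -e win_shift; congr win; lia.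
Qed.

(** By minimality the windows of every [y] in [X] occur in [x], so a period of [x] is a period of
    all of [X], and only finitely many sequences have a given period. *)
Lemma minimal_aperiodic1 x (d : nat) : subshift_set X x -> (0 < d)%N ->
  exists p : int, x p != x (p + d%:Z).
Proof.
move=> Xx; case: d => // d _; apply: contrapT => nper.
have {}nper p : x p = x (p + d.+1%:Z).
  by apply/eqP; apply: contrapT => /negP ?; apply: nper; exists p.
apply: Xinf.
pose f (g : {ffun 'I_d.+1 -> bool}) : full_shift :=
  fun n : int => g (inord `|(n %% d.+1)%Z|%N).
apply: (@sub_finite_set _ _ (f @` setT)); last exact/finite_image/finite_finset.
move=> y Xy; exists [ffun i : 'I_d.+1 => y i%:Z] => //.
have yper p : y p = y (p + d.+1%:Z).
  have [G /(_ x 0 Xx) [i _]] := minimal_syndetic p d.+2 Xy.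
  move/win_inj => e; have := e 0%N isT; have := e d.+1 (ltnSn _).
  by rewrite -nper !addr0 => -> ->.
have ypern (p : int) (k : nat) : y (p + k%:Z * d.+1%:Z) = y p.
  elim: k => [|k IH]; first by rewrite mul0r addr0.
  by rewrite -[RHS]IH [RHS]yper -addrA intS mulrDl mul1r [_ + d.+1%:Z]addrC.
apply/funext => n; rewrite /f ffunE inordK; last first.
  by rewrite -ltz_nat gez0_abs ?modz_ge0 // ltz_pmod.
rewrite gez0_abs ?modz_ge0 //.
rewrite {2}(divz_eq n d.+1); case: (n %/ d.+1)%Z => k.
  by rewrite addrC ypern.
by rewrite -[RHS](ypern _ k.+1) NegzE mulNr addrAC addNr add0r.
Qed.

(** A window of length [D.+2] that witnesses the failure of the period [D.+1] in one point recurs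
    with bounded gaps in every point. *)
Lemma minimal_aperiodic (D : nat) :
  exists n : nat, forall x (a : int) (d : nat),
    subshift_set X x -> (0 < d <= D)%N ->
    exists2 i : nat, (i < n)%N & x (a + i%:Z) != x (a + i%:Z + d%:Z).
Proof.
have [x0 Xx0] := minimal_nonempty.
elim: D => [|D [n IH]]; first by exists 0%N => x a d _; lia.
have [p pP] := minimal_aperiodic1 Xx0 (ltn0Sn D).
have [G GP] := minimal_syndetic p D.+2 Xx0.
exists (maxn n G) => x a d Xx dD.
have [dlt|Dlt] := leqP d D.
  have [|i il e] := IH x a d Xx; first by lia.
  by exists i => //; lia.
have -> : d = D.+1 by lia.
have [i iG /win_inj e] := GP x a Xx.
exists i; first by lia.
have := e 0%N isT; have := e D.+1 (ltnSn _).
by rewrite !addr0 => -> ->.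
Qed.

(** The binary value of a window, most significant letter first: on windows of equal length its
    order is the lexicographic one. *)
Fixpoint num (x : int -> bool) (p : int) (n : nat) : nat :=
  if n is n'.+1 then (2 * num x p n' + x (p + n'%:Z)%R)%N else 0%N.

Lemma num_lt x p n : (num x p n < 2 ^ n)%N.
Proof. elim: n => //= n IH; rewrite expnS; case: (x _); lia. Qed.

Lemma num_cat x p m n :
  num x p (m + n) = (num x p m * 2 ^ n + num x (p + m%:Z)%R n)%N.
Proof.
elim: n => [|n IH] /=; first by rewrite addn0 muln1 addn0.
by rewrite addnS /= IH expnS PoszD addrA mulnDr mulnCA addnA.
Qed.

Lemma num_inj x y p q n : num x p n = num y q n -> win x p n = win y q n.
Proof.
move=> e; apply: eq_win; elim: n e => // n IH /= e i.
have [e1 e2] : num x p n = num y q n /\ x (p + n%:Z) = y (q + n%:Z).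
  by case: (x _) e; case: (y _) => /= e; split => //; lia.
by rewrite ltnS leq_eqVlt => /predU1P[->|/IH] //; apply.
Qed.

Lemma eq_num x y p q n : win x p n = win y q n -> num x p n = num y q n.
Proof.
move=> /win_inj e; elim: n e => //= n IH e.
by rewrite IH => [|i il]; rewrite e // ltnW.
Qed.

(* If x[0, n) is lexicographically largest, then a square uu centred at 0,
   x[-d, n) = u x[0, n) being at most x[0, n) = u x[d, n), would force
   x[0, n-d) <= x[d, n), hence equality: x would have period d on [0, n). *)
Lemma no_centred_square (D : nat) : exists2 x, subshift_set X x &
  forall d : nat, (0 < d <= D)%N -> win x (- d%:Z) d <> win x 0 d.
Proof.
have [n nP] := minimal_aperiodic D.
(* After removing [d <= D] letters from length [n + D], at least [n] remain, enough for [nP] to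
   refute the period [d]. *)
have [N ND] : exists N, N = (n + D)%N by exists (n + D)%N.
pose Q := fun m => `[< exists2 x, subshift_set X x & num x 0 N = m >].
have exQ : exists m, Q m.
  by have [x Xx] := minimal_nonempty; exists (num x 0 N); apply/asboolP; exists x.
have ubQ m : Q m -> (m <= 2 ^ N)%N.
  by move=> /asboolP[x _ <-]; exact/ltnW/num_lt.
case: (ex_maxnP exQ ubQ) => m /asboolP[x Xx xm] mmax.
exists x => // d dD sq.
have max y : subshift_set X y -> (num y 0 N <= num x 0 N)%N.
  by move=> Xy; rewrite xm; apply: mmax; apply/asboolP; exists y.
have [k NE] : exists k, N = (d + k)%N by exists (N - d)%N; lia.
have shiftE y (a : int) m' : num (shift_by a y) 0 m' = num y a m'.
  by apply: eq_num; rewrite win_shift add0r.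
have nk : (n <= k)%N by lia.
have le1 := max _ (subshift_shift (- d%:Z) Xx).
have le2 := max _ (subshift_shift d%:Z Xx).
move: le1 le2; rewrite !shiftE {1 2}NE !num_cat addNr add0r (eq_num sq).
rewrite leq_add2l => le1.
have -> : N = (k + d)%N by rewrite NE addnC.
rewrite !num_cat => le2.
have lt1 := num_lt x (0 + k%:Z) d; have lt2 := num_lt x (d%:Z + k%:Z) d.
have le3 : (num x d k <= num x 0 k)%N.
  rewrite leqNgt; apply/negP => lt.
  move: (leq_mul lt (leqnn (2 ^ d))) le2 lt1; rewrite mulSn; clear.
  move: (num x d k * _)%N => a; move: (num x 0%R k * _)%N => b.
  move: (num x _ d) => c; move: (num x _ d) (2 ^ d)%N => e f; lia.
have /num_inj/win_inj e : num x d k = num x 0 k by apply/eqP; rewrite eqn_leq le3.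
have [i iin /negP] := nP x 0 d Xx dD; apply; apply/eqP.
by rewrite -(e i (leq_trans iin nk)); congr (x _); rewrite add0r addrC.
Qed.

End MinimalSubshift.

(** * Dictionaries of a rank-n construction *)

(** Unlike in a building, every word, the last one included, is followed by a run of 1s; such
    products are closed under concatenation. *)
Definition spaced_word (l : seq (word * nat)) : word :=
  flatten [seq p.1 ++ nseq p.2 true | p <- l].

Lemma spaced_word_cat l1 l2 :
  spaced_word (l1 ++ l2) = spaced_word l1 ++ spaced_word l2.
Proof. by rewrite /spaced_word map_cat flatten_cat. Qed.

Definition spaced (S : seq word) (w : word) : Prop :=
  exists l : seq (word * nat),
    [/\ l != [::], {in l, forall p, p.1 \in S} & w = spaced_word l].

Lemma spaced_cat S w1 w2 : spaced S w1 -> spaced S w2 -> spaced S (w1 ++ w2).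
Proof.
move=> [l1 [n1 m1 ->]] [l2 [n2 m2 ->]]; exists (l1 ++ l2); split.
- by case: l1 n1 {m1}.
- by move=> p; rewrite mem_cat => /orP[/m1|/m2].
- by rewrite spaced_word_cat.
Qed.

Lemma spaced_nseq S w s : spaced S w -> spaced S (w ++ nseq s true).
Proof.
move=> [l [+ + ->]]; case/lastP: l => // l [u t] _ m.
exists (rcons l (u, (t + s)%N)); split.
- by case: l {m}.
- move=> p; rewrite mem_rcons inE => /predU1P[->|pl] /=.
    by apply: (m (u, t)); rewrite mem_rcons inE eqxx.
  by apply: m; rewrite mem_rcons inE pl orbT.
- rewrite -!cats1 !spaced_word_cat -catA; congr (_ ++ _).
  by rewrite /spaced_word /= !cats0 nseqD catA.
Qed.

Lemma spaced_building S w b : is_building S w b ->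
  forall S', {in S, forall u, spaced S' u} -> spaced S' w.
Proof.
move=> [_ _ + + ->] S' SS'; rewrite /building_word.
move=> /SS'; move: (building_first b); elim: (building_rest b) => [|[s u] l IH] w' Sw' lS /=.
  by rewrite cats0.
rewrite -catA catA catA; apply: IH; last by move=> p pl; apply: lS; rewrite inE pl orbT.
apply: spaced_cat; first exact: spaced_nseq.
by apply: SS'; apply: (lS (s, u)); rewrite inE eqxx.
Qed.

Section FiniteRank.
Variables (n : nat) (V : nat -> bool) (ns : nat -> nat) (v : nat -> nat -> word).
Hypothesis gen : generating_sequence n ns v.
Hypothesis limV : word_limit (fun i => v i 1%N) V.

Lemma level_built i (w : word) : w \in level ns v i.+1 -> built_from (level ns v i) w.
Proof.
case: gen => _ _ g1 g2 /mapP[j]; rewrite mem_iota => /andP[j1 jn] ->.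
move: j1; rewrite leq_eqVlt => /predU1P[<-|j2]; first by have [b] := g1 i; exists b.
by apply: g2; rewrite j2 /=; lia.
Qed.

Lemma first_in_level i : v i 1%N \in level ns v i.
Proof.
by case: gen => /(_ i) + _ _ _ => h; apply: map_f; rewrite mem_iota; lia.
Qed.

(** A building uses at least two words, so lengths grow strictly from level to level. *)
Lemma size_level_word i (w : word) : w \in level ns v i -> (i < size w)%N.
Proof.
elim: i w => [|i IH] w.
  case: gen => _ g0 _ _ /mapP[j]; rewrite mem_iota => jn ->.
  by rewrite g0 //; lia.
move=> /level_built[[w1 l] [/= _ l0 /IH w1i lS ->]].
case: l l0 lS => // [[s u] l] _ lS; rewrite /building_word /= !size_cat.
have /IH := lS (s, u) (mem_head _ _) => /=; lia.
Qed.

Lemma level_spaced i j (w : word) : (i <= j)%N -> w \in level ns v j ->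
  spaced (level ns v i) w.
Proof.
move=> /subnK <-; elim: (j - i)%N w => {j} [|k IH] w.
  move=> iw; exists [:: (w, 0%N)]; split => //; first by move=> p; rewrite inE => /eqP ->.
  by rewrite /spaced_word /= !cats0.
by rewrite addSn => /level_built[b /spaced_building]; apply.
Qed.

Lemma first_prefix i j : (i <= j)%N -> prefix (v i 1%N) (v j 1%N).
Proof.
move=> /subnK <-; elim: (j - i)%N => {j} [|k IH]; first exact: prefix_refl.
apply: prefix_trans IH _; rewrite addSn; case: gen => _ _ /(_ (k + i)%N) [b [_ _ _ _ ->]].
by move=> <- _; rewrite /building_word prefix_prefix.
Qed.

Lemma first_limit i m : (m < size (v i 1%N))%N -> nth false (v i 1%N) m = V m.
Proof.
move=> mi; have [N /(_ (maxn i N) (leq_maxr _ _)) [mN <-]] := limV m.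
by have /prefixP[s ->] := first_prefix (leq_maxl i N); rewrite nth_cat mi.
Qed.

Variable M : nat.
Hypothesis runV : ~ subword_N (nseq M.+1 true) V.

Lemma spaced_run i l : v i 1%N = spaced_word l -> {in l, forall p, (p.2 <= M)%N}.
Proof.
move=> vl [u t] pl; rewrite leqNgt; apply/negP => /= Mt.
have [l1 [l2 lE]] : exists l1 l2, l = l1 ++ (u, t) :: l2 by case/splitPr: pl => l1 l2; exists l1, l2.
apply: runV; exists (size (spaced_word l1 ++ u)); rewrite size_nseq.
have vE : v i 1%N = (spaced_word l1 ++ u) ++ nseq t true ++ spaced_word l2.
  by rewrite vl lE spaced_word_cat /spaced_word /= -!catA.
apply: (@eq_from_nth _ false); rewrite ?size_mkseq size_nseq // => k kM.
rewrite nth_mkseq // nth_nseq kM -(@first_limit i) ?vE.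
  rewrite nth_cat ltnNge leq_addr /= addKn nth_cat size_nseq nth_nseq.
  by have -> : (k < t)%N by lia.
by rewrite !size_cat size_nseq; lia.
Qed.

(** Runs of 1s have length at most [M], so each can be attached to the word before it. This replaces
    spacers by plain concatenation, at the cost of a factor [M.+1] that does not depend on the
    level. *)
Definition dictionary (i : nat) : seq word :=
  [seq w ++ nseq s true | w <- level ns v i, s <- iota 0 M.+1].

Lemma size_dictionary i : (size (dictionary i) <= n * M.+1)%N.
Proof.
rewrite size_allpairs size_map !size_iota leq_mul2r /=.
by case: gen => /(_ i) /andP[].
Qed.

Lemma dictionary_long i (c : word) : c \in dictionary i -> (i < size c)%N.
Proof.
move=> /allpairsP[[w s] [/size_level_word /= wi _ ->]]; rewrite size_cat; lia.
Qed.

(** The word [u] lies in [v j 1] for some [j >= i], and [v j 1] decomposes into words of level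
    [i]. *)
Lemma dictionary_parse i (u : word) : subword_N u V ->
  exists2 s, all (mem (dictionary i)) s & infix u (flatten s).
Proof.
move=> [a uE]; have [N] := limV (a + size u)%N.
move=> /(_ (maxn N i) (leq_maxl _ _)); set j := maxn N i => -[szj _].
have [l [_ lS vl]] := level_spaced (leq_maxr N i) (first_in_level j).
exists [seq p.1 ++ nseq p.2 true | p <- l].
  apply/allP => _ /mapP[p pl ->]; apply/allpairsP; exists p; split => //.
    exact: lS.
  by rewrite mem_iota add0n ltnS /=; exact: (spaced_run vl pl).
rewrite -[flatten _]/(spaced_word l) -vl.
apply/infixP; exists (take a (v j 1%N)), (drop (a + size u) (v j 1%N)).
rewrite -{1}(cat_take_drop (a + size u) (v j 1%N)) catA; congr (_ ++ _).
have szE : size (take (a + size u) (v j 1%N)) = (a + size u)%N by rewrite size_takel // ltnW.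
have sza : size (take a (v j 1%N)) = a by rewrite size_takel //; lia.
apply: (@eq_from_nth _ false); rewrite szE ?size_cat ?sza // => k kl.
rewrite nth_take // nth_cat sza; case: ltnP => ka; first by rewrite nth_take.
rewrite uE nth_mkseq; last by lia.
by rewrite first_limit; [congr V; lia | lia].
Qed.

End FiniteRank.

Lemma finite_rank_dictionary (X : subshift) :
  infinite_set (subshift_set X) -> minimal_subshift X ->
  finite_symbolic_rank (subshift_set X) ->
  exists d : nat, forall L : nat, exists C : seq word,
    [/\ (size C <= d)%N, {in C, forall c : word, (L < size c)%N} &
      forall x p n, subshift_set X x ->
        exists2 s, all (mem C) s & infix (win x p n) (flatten s)].
Proof.
move=> Xinf Xmin [n [V [_ [ns [v [b [[gen _ _] limV]]]] XV]]].
(* Unbounded runs would put the constant sequence 1, of period 1, into [X]. *)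
have [M runV] : exists M, ~ subword_N (nseq M.+1 true) V.
  apply: contrapT => /forallNP noM.
  have {}noM m : subword_N (nseq m true) V.
    case: m => [|m]; first by exists 0%N.
    by have := noM m => /contrapT.
  pose x : full_shift := fun=> true.
  have Xx : subshift_set X x.
    rewrite XV => u [a ->]; suff -> : mkseq (fun=> true) (size u) = nseq (size u) true by [].
    by apply: (@eq_from_nth _ false); rewrite ?size_mkseq ?size_nseq // => i il;
       rewrite nth_mkseq // nth_nseq il.
  by have [p] := minimal_aperiodic1 Xinf Xmin Xx (ltn0Sn 0).
exists (n * M.+1)%N => L; exists (dictionary ns v M L); split.
- exact: size_dictionary gen _ _.
- by move=> c; apply: dictionary_long gen _ _ _.
- move=> x p m Xx; apply: (dictionary_parse gen limV runV).
  have : subshift_of_word V x by rewrite -XV.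
  by apply; exists p; rewrite size_win.
Qed.

(** * Markers and bases with few return words *)

Section Cuts.
Variable s : seq word.

Definition cut (j : nat) : nat := size (flatten (take j s)).

Lemma cutS j : cut j.+1 = (cut j + size (nth [::] s j))%N.
Proof.
rewrite /cut; case: (ltnP j (size s)) => js.
  by rewrite (take_nth [::]) // -cats1 flatten_cat size_cat /= cats0.
by rewrite nth_default // !take_oversize ?addn0 // ltnW.
Qed.

Lemma leq_cut i j : (i <= j)%N -> (cut i <= cut j)%N.
Proof.
move=> /subnK <-; elim: (j - i)%N => {j} //= k IH.
by rewrite addSn cutS; exact: leq_trans IH (leq_addr _ _).
Qed.

Lemma cut_size : cut (size s) = size (flatten s).
Proof. by rewrite /cut take_size. Qed.

Lemma cut_cover k : (k < size (flatten s))%N ->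
  exists2 j, (j < size s)%N & (cut j <= k < cut j.+1)%N.
Proof.
rewrite -cut_size => ks; have exj : exists j, (k < cut j)%N by exists (size s).
case: (ex_minnP exj) => -[|j kj jmin]; first by rewrite /cut take0.
exists j; first exact: jmin.
by rewrite kj andbT leqNgt; apply/negP => /jmin; rewrite ltnn.
Qed.

Lemma nth_flatten_cut j i : (i < size (nth [::] s j))%N ->
  nth false (flatten s) (cut j + i) = nth false (nth [::] s j) i.
Proof.
move=> il; have js : (j < size s)%N.
  by rewrite ltnNge; apply/negP => js; rewrite nth_default in il.
rewrite -{1}(cat_take_drop j s) flatten_cat nth_cat ltnNge leq_addr /= addKn.
by rewrite (drop_nth [::]) //= nth_cat il.
Qed.

End Cuts.

Section Markers.
Variable X : subshift.
Hypothesis Xinf : infinite_set (subshift_set X).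
Hypothesis Xmin : minimal_subshift X.
Variables (C : seq word) (K : nat).
Hypothesis C_size : {in C, forall c : word, (0 < size c <= K)%N}.
Hypothesis C_parse : forall x p n, subshift_set X x ->
  exists2 s, all (mem C) s & infix (win x p n) (flatten s).
Variable z : full_shift.
Hypothesis z_square :
  forall d : nat, (0 < d <= K)%N -> win z (- d%:Z) d <> win z 0 d.
Variables M R : nat.
Hypothesis M_gt0 : (0 < M)%N.
Hypothesis KM : (K <= M)%N.

Definition marker (x : full_shift) (m : int) : Prop :=
  win x (m - M%:Z) (M + M) = win z (- M%:Z) (M + M).

Hypothesis marker_syndetic : forall x (a : int), subshift_set X x ->
  exists2 i : nat, (i < R)%N & marker x (a + i%:Z).
(** The gap [K + K] leaves room in each block for a whole word after the one that reaches across its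
    left marker. *)
Hypothesis marker_sparse : forall x m (r : nat), subshift_set X x ->
  marker x m -> marker x (m + r%:Z) -> (0 < r)%N -> (K + K < r)%N.

(* The marker word has no square at its centre, so a word of the dictionary
   covers the centre of a marker in at most one way. *)
Definition offset (c : word) : nat :=
  find (fun o : nat => win z (- o%:Z) (size c) == c) (iota 0 (size c).+1).

(** Offsets run from 0 (the word starts at the marker) to [size c] (it ends there), both included.
    Occurrences at offsets [k < l] overlay to a square of period [l - k] centred at 0. *)
Lemma offset_unique (c : word) (o : nat) : c \in C -> (o <= size c)%N ->
  win z (- o%:Z) (size c) = c -> o = offset c.
Proof.
move=> /C_size /andP[c0 cK] oc zo.
pose a := fun o : nat => win z (- o%:Z) (size c) == c.
have ha : has a (iota 0 (size c).+1).
  by apply/hasP; exists o; [rewrite mem_iota; lia | rewrite /a zo].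
have := nth_find 0%N ha; move: ha; rewrite has_find size_iota -/(offset c) => lt.
rewrite nth_iota // add0n => /eqP zo'.
have square k l : (k < l <= size c)%N -> win z (- k%:Z) (size c) = c ->
    win z (- l%:Z) (size c) = c -> False.
  move=> kl zk zl; apply: (@z_square (l - k)%N); first by lia.
  have zkl : win z (- l%:Z) (size c) = win z (- k%:Z) (size c) by rewrite zk.
  apply: eq_win => i il.
  have ik : (i + k < size c)%N by lia.
  have := win_inj zkl ik.
  have -> : - l%:Z + (i + k)%N%:Z = - (l - k)%N%:Z + i%:Z by lia.
  by have -> : - k%:Z + (i + k)%N%:Z = 0 + i%:Z by lia.
case: (ltngtP o (offset c)) => // h.
  by case: (square _ _ _ zo zo'); lia.
by case: (square _ _ _ zo' zo); lia.
Qed.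

(** * Parsings between consecutive markers *)

Definition consecutive (x : full_shift) (m : int) (r : nat) : Prop :=
  [/\ marker x m, marker x (m + r%:Z), (0 < r)%N &
      forall i : nat, (0 < i < r)%N -> ~ marker x (m + i%:Z)].

Lemma consecutive_exists x m : subshift_set X x -> marker x m ->
  exists r, consecutive x m r.
Proof.
move=> Xx xm; have [i0 _ mi0] := marker_syndetic (m + 1) Xx.
pose Q := fun r : nat => (0 < r)%N && `[< marker x (m + r%:Z) >].
have exQ : exists r, Q r.
  exists i0.+1; rewrite /Q /=; apply/asboolP.
  by have -> : m + i0.+1%:Z = m + 1 + i0%:Z by lia.
case: (ex_minnP exQ) => r /andP[r0 /asboolP mr] rmin; exists r; split => //.
move=> i /andP[i0' ir] mi; suff : (r <= i)%N by rewrite leqNgt ir.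
by apply: rmin; rewrite /Q i0'; apply/asboolP.
Qed.

Lemma consecutive_le x m r : subshift_set X x -> consecutive x m r -> (r <= R)%N.
Proof.
move=> Xx [_ _ _ nom]; rewrite leqNgt; apply/negP => Rr.
have [i iR mi] := marker_syndetic (m + 1) Xx.
apply: (nom i.+1); first by lia.
by have -> : m + i.+1%:Z = m + 1 + i%:Z by lia.
Qed.

Lemma consecutive_gt x m r : subshift_set X x -> consecutive x m r -> (K + K < r)%N.
Proof. by move=> Xx [xm xr r0 _]; exact: marker_sparse xm xr r0. Qed.

Lemma consecutive_lt x m r m' r' : consecutive x m r -> consecutive x m' r' ->
  m < m' -> m + r%:Z <= m'.
Proof.
move=> [_ _ _ nom] [mm' _ _ _] lt; rewrite leNgt; apply/negP => lt'.
apply: (nom `|(m' - m)%R|%N); first by lia.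
by have -> : m + `|(m' - m)%R|%N%:Z = m' by lia.
Qed.

Lemma consecutive_eq x m r r' :
  consecutive x m r -> consecutive x m r' -> r = r'.
Proof.
move=> [_ mr r0 nom] [_ mr' r0' nom'].
case: (ltngtP r r') => // h; first by case: (nom' r); rewrite ?r0.
by case: (nom r'); rewrite ?r0'.
Qed.

(* A parsing of u chosen once and for all: u starts at index [(parse u).2] of
   the concatenation of the words [(parse u).1]. *)
Definition parse (u : word) : seq word * nat :=
  xget ([::], 0%N) [set so : seq word * nat | all (mem C) so.1 /\
    exists u', drop so.2 (flatten so.1) = u ++ u'].

Lemma parseP x p n : subshift_set X x ->
  all (mem C) (parse (win x p n)).1 /\
  exists u', drop (parse (win x p n)).2 (flatten (parse (win x p n)).1) =
             win x p n ++ u'.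
Proof.
move=> Xx; have [s sC /infixP[u1 [u2 e]]] := C_parse p n Xx.
rewrite /parse; case: xgetP => [so -> //|].
move=> /(_ (s, size u1)) /= []; split => //; exists u2.
by rewrite e drop_size_cat.
Qed.

Section Block.
Variables (x : full_shift) (m : int) (r : nat).
Hypothesis Xx : subshift_set X x.
Hypothesis cons : consecutive x m r.

(** The text read extends [M >= K] letters beyond both markers, so a dictionary word of the parsing
    that touches a marker lies inside it and really occurs in [x]. *)
Let u := win x (m - M%:Z) (r + (M + M)).
Definition block_words : seq word := (parse u).1.
Definition block_cut (j : nat) : int :=
  m - M%:Z - (parse u).2%:Z + (cut block_words j)%:Z.
Definition block_word (j : nat) : word := nth [::] block_words j.

Lemma block_cutS j : block_cut j.+1 = block_cut j + (size (block_word j))%:Z.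
Proof. by rewrite /block_cut cutS PoszD addrA. Qed.

Lemma le_block_cut i j : (i <= j)%N -> block_cut i <= block_cut j.
Proof. by move=> ij; rewrite /block_cut lerD2l lez_nat leq_cut. Qed.

Lemma lt_block_cut i j : block_cut i < block_cut j -> (i < j)%N.
Proof. by move=> ij; rewrite ltnNge; apply/negP => /le_block_cut; lia. Qed.

Lemma block_word_in j : (j < size block_words)%N -> block_word j \in C.
Proof.
move=> js; have [/allP sC _] := parseP (m - M%:Z) (r + (M + M)) Xx.
by apply: sC; exact: mem_nth.
Qed.

Lemma block_nth (k : nat) : (k < r + (M + M))%N ->
  ((parse u).2 + k < size (flatten block_words))%N /\
  nth false (flatten block_words) ((parse u).2 + k) = x (m - M%:Z + k%:Z).
Proof.
move=> kr; have [_ [u']] := parseP (m - M%:Z) (r + (M + M)) Xx.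
rewrite -/u -/block_words => e; split.
  have := congr1 size e; rewrite size_drop size_cat size_win; lia.
by rewrite -nth_drop e nth_cat size_win kr nth_win.
Qed.

Lemma block_cover (a : int) : m - M%:Z <= a -> a < m + r%:Z + M%:Z ->
  exists2 j, (j < size block_words)%N & block_cut j <= a < block_cut j.+1.
Proof.
move=> am ar; have [|lt _] := @block_nth `|(a - (m - M%:Z))%R|%N; first by lia.
have [j js jk] := cut_cover lt; exists j => //.
by rewrite /block_cut; lia.
Qed.

Lemma block_occurs j : m - M%:Z <= block_cut j ->
  block_cut j.+1 <= m + r%:Z + M%:Z ->
  win x (block_cut j) (size (block_word j)) = block_word j.
Proof.
move=> mj jr; apply: (@eq_from_nth _ false); rewrite size_win // => i il.
rewrite nth_win // /block_word -nth_flatten_cut //.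
rewrite block_cutS in jr.
have [|_] := @block_nth `|(block_cut j + i%:Z - (m - M%:Z))%R|%N; first by lia.
have -> : m - M%:Z + `|(block_cut j + i%:Z - (m - M%:Z))%R|%N%:Z =
          block_cut j + i%:Z by lia.
by move=> <-; congr (nth _ _ _); rewrite /block_cut in mj jr *; lia.
Qed.

End Block.

(* The dictionary word c occurs at q in the parsing of a block, and lies between
   the two markers delimiting the block. *)
Definition tile (x : full_shift) (q : int) (c : word) : Prop :=
  exists m r j, [/\ consecutive x m r, (j < size (block_words x m r))%N,
    q = block_cut x m r j /\ c = block_word x m r j, m <= q &
    q + (size c)%:Z <= m + r%:Z].

Lemma tile_word x q (c : word) : subshift_set X x -> tile x q c ->
  c \in C /\ win x q (size c) = c.
Proof.
move=> Xx [m [r [j [cons js [-> ->] mq qr]]]]; split; first exact: block_word_in.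
by apply: block_occurs => //; rewrite ?block_cutS; lia.
Qed.

Lemma tile_gt0 x q (c : word) : subshift_set X x -> tile x q c -> (0 < size c <= K)%N.
Proof. by move=> Xx /(tile_word Xx) [/C_size]. Qed.

(** Tiles are nonempty and blocks overlap at most in an endpoint, so both tiles belong to one
    parsing, whose cuts increase. *)
Lemma tile_unique x q (c c' : word) : tile x q c -> tile x q c' ->
  subshift_set X x -> c = c'.
Proof.
move=> t t' Xx; have := tile_gt0 Xx t; have := tile_gt0 Xx t'.
case: t => m [r [j [cons js [qE cE] mq qr]]].
case: t' => m' [r' [j' [cons' js' [qE' cE'] mq' qr']]] c0 c0'.
have mm : m' = m.
  case: (ltgtP m m') => // h; first by have := consecutive_lt cons cons' h; lia.
  by have := consecutive_lt cons' cons h; lia.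
subst m'; have rr := consecutive_eq cons' cons; subst r'.
have jj : j' = j.
  case: (ltngtP j' j) => // /(le_block_cut x m r); rewrite block_cutS.
    by rewrite -cE' -qE -qE'; lia.
  by rewrite -cE -qE -qE'; lia.
by rewrite cE cE' jj.
Qed.

Lemma tile_disjoint x q (c : word) q' (c' : word) : tile x q c -> tile x q' c' ->
  subshift_set X x -> q < q' -> q + (size c)%:Z <= q'.
Proof.
move=> t t' Xx qq'; have := tile_gt0 Xx t; have := tile_gt0 Xx t'.
case: t => m [r [j [cons js [qE cE] mq qr]]].
case: t' => m' [r' [j' [cons' js' [qE' cE'] mq' qr']]] c0 c0'.
case: (ltgtP m m') => h; first by have := consecutive_lt cons cons' h; lia.
  by have := consecutive_lt cons' cons h; lia.
subst m'; have rr := consecutive_eq cons' cons; subst r'.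
rewrite qE qE' in qq'; have /(le_block_cut x m r) := lt_block_cut qq'.
by rewrite block_cutS -cE -qE -qE'.
Qed.

(** * Return words and the base *)

Variable delta : word -> nat.

(* A tile c carries a base point at distance [delta c] from its start.  The two
   families are the words between the base points of consecutive tiles c, c'
   of one block, and those of the last tile c of a block and the first tile e'
   of the next, where p = (c, c1), q = (e, e'), and c1 and e are the words
   covering the marker in the two parsings. *)
Definition return_words : seq word :=
  [seq drop (delta c) c ++ take (delta c') c' | c <- C, c' <- C] ++
  [seq drop (delta p.1) p.1 ++
       win z (- (offset p.2)%:Z) (offset p.2 + size q.1 - offset q.1) ++
       take (delta q.2) q.2 |
     p <- [seq (a, b) | a <- C, b <- C], q <- [seq (a, b) | a <- C, b <- C]].

Lemma size_return_words :
  size return_words = (size C ^ 2 + size C ^ 4)%N.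
Proof. by rewrite size_cat !size_allpairs !expnS expn0 muln1 !mulnA. Qed.

Lemma win_tiles x q (c : word) q' (c' : word) (l : nat) : (delta c <= size c)%N ->
  (delta c' <= size c')%N ->
  win x q (size c) = c -> win x q' (size c') = c' ->
  q' = q + (size c)%:Z + l%:Z ->
  win x (q + (delta c)%:Z) (size c - delta c + l + delta c')%N =
  drop (delta c) c ++ win x (q + (size c)%:Z) l ++ take (delta c') c'.
Proof.
move=> dc dc' xc xc' q'E.
have -> : drop (delta c) c = win x (q + (delta c)%:Z) (size c - delta c).
  by rewrite -(win_drop x q dc) xc.
have -> : take (delta c') c' = win x q' (delta c') by rewrite -(win_take x q' dc') xc'.
rewrite -addnA win_cat; congr (_ ++ _).
have -> : q + (delta c)%:Z + (size c - delta c)%N%:Z = q + (size c)%:Z by lia.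
by rewrite win_cat q'E.
Qed.

(** If the next word of the parsing ends at or before the right marker, it is the next tile.
    Otherwise it is the word [c1] across the marker, and the next tile is the first one of the
    following block. *)
Lemma tile_next x q (c : word) : subshift_set X x ->
  {in C, forall c : word, delta c <= size c}%N ->
  tile x q c -> exists q' c',
  [/\ tile x q' c', q < q',
      forall q'' c'', tile x q'' c'' -> q < q'' -> q' <= q'' &
      win x (q + (delta c)%:Z)
          `|(q' + (delta c')%:Z - (q + (delta c)%:Z))%R|%N \in return_words].
Proof.
move=> Xx dC t; have [cC xc] := tile_word Xx t.
have /andP[c0 cK] := C_size cC.
case: (t) => m [r [j [cons js [qE cE] mq qr]]].
have qS : block_cut x m r j.+1 = q + (size c)%:Z by rewrite block_cutS -qE -cE.
(* [c1] covers the letter at the marker itself, hence ends strictly beyond it and is not a tile. *)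
have [||j1 js1 /andP[j1le j1lt]] := @block_cover x m r Xx (m + r%:Z); [lia|lia|].
have /C_size /andP[c10 c1K] := block_word_in Xx js1.
set c1 := block_word x m r j1 in c10 c1K.
have jj1 : (j < j1)%N.
  by rewrite -ltnS; apply: (@lt_block_cut x m r); rewrite qS; lia.
move: jj1; rewrite leq_eqVlt => /predU1P[j1E|jj1]; last first.
  have js' : (j.+1 < size (block_words x m r))%N by exact: ltn_trans js1.
  pose c' := block_word x m r j.+1.
  have /C_size /andP[c'0 c'K] := block_word_in Xx js'.
  have t' : tile x (q + (size c)%:Z) c'.
    exists m, r, j.+1; split => //; first by lia.
    by rewrite -qS -block_cutS; have := le_block_cut x m r jj1; lia.
  have [c'C xc'] := tile_word Xx t'.
  exists (q + (size c)%:Z), c'; split => //; first by lia.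
    by move=> q'' c'' t'' qq; apply: tile_disjoint t t'' Xx qq.
  rewrite mem_cat; apply/orP; left; apply/allpairsP; exists (c, c'); split => //=.
  have := @win_tiles x q c (q + (size c)%:Z) c' 0 (dC c cC) (dC c' c'C) xc xc' ltac:(lia).
  move=> /= <-; congr win; have := dC c cC; lia.
have xm' : marker x (m + r%:Z) by case: cons.
set m' := m + r%:Z in xm' j1le j1lt qr.
have [r' cons'] := consecutive_exists Xx xm'.
have r'K := consecutive_gt Xx cons'.
(* In the next block [e] covers the letter just before the marker, so the end of [e] is the first
   cut at or after the marker. *)
have [||j2 js2 /andP[j2le j2lt]] := @block_cover x m' r' Xx (m' - 1); [lia|lia|].
have eC := block_word_in Xx js2; have /C_size /andP[e0 eK] := eC.
have j2S := block_cutS x m' r' j2.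
set e := block_word x m' r' j2 in e0 eK eC j2S.
(* The word found here witnesses that the parsing continues after [e]. *)
have [||j3 js3 /andP[j3le j3lt]] :=
  @block_cover x m' r' Xx (block_cut x m' r' j2.+1); [lia|lia|].
have {js3 j3le j3lt j3} js3 : (j2.+1 < size (block_words x m' r'))%N.
  by apply: leq_ltn_trans js3; rewrite -ltnS; exact: lt_block_cut j3lt.
pose e' := block_word x m' r' j2.+1.
have := block_word_in Xx js3; rewrite -/e' => /C_size /andP[e'0 e'K].
have t' : tile x (block_cut x m' r' j2.+1) e'.
  exists m', r', j2.+1; split => //; first by lia.
  lia.
have [e'C xe'] := tile_word Xx t'.
have qS1 : block_cut x m r j1 = q + (size c)%:Z by rewrite -j1E qS.
exists (block_cut x m' r' j2.+1), e'; split => //; first by lia.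
  (* No tile fits in between: in the old block every word from [c1] on ends beyond the marker, and
     in the new block a cut before [e'] is at most the start of [e], which precedes the marker. *)
  move=> q'' c'' t'' qq; have le1 := tile_disjoint t t'' Xx qq.
  have c''0 := tile_gt0 Xx t''.
  rewrite leNgt; apply/negP => lt2.
  case: t'' => m'' [r'' [j'' [cons'' js'' [qE'' cE''] mq'' qr'']]].
  case: (ltgtP m' m'') => h; first by have := consecutive_lt cons' cons'' h; lia.
    have h' := consecutive_lt cons'' cons' h.
    case: (ltgtP m m'') => h2; last 1 first.
    - subst m''; have rr := consecutive_eq cons'' cons; subst r''.
      have : (j1 <= j'')%N.
        by rewrite -ltnS; apply: (@lt_block_cut x m r); rewrite block_cutS -qE'' -cE''; lia.
      move=> /(@le_block_cut x m r j1.+1 j''.+1); rewrite [leRHS]block_cutS -qE'' -cE''; lia.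
    - by have := consecutive_lt cons cons'' h2; lia.
    - by have := consecutive_lt cons'' cons h2; lia.
  subst m''; have rr := consecutive_eq cons'' cons'; subst r''.
  have : (j2 < j'')%N by apply: (@lt_block_cut x m' r'); lia.
  by move=> /(@le_block_cut x m' r'); lia.
have xc1 : win x (block_cut x m r j1) (size c1) = c1.
  by apply: block_occurs => //; rewrite ?block_cutS -/c1; lia.
have xe : win x (block_cut x m' r' j2) (size e) = e.
  by apply: block_occurs => //; rewrite ?block_cutS -/e; lia.
have c1C : c1 \in C := block_word_in Xx js1.
(* An occurrence touching the marker lies inside the marker word, because [K <= M], and there
   [offset_unique] fixes its place. *)
have occ a (w : word) : w \in C -> m' - (size w)%:Z <= a -> a <= m' ->
    win x a (size w) = w -> a = m' - (offset w)%:Z.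
  move=> wC aw am xw; have /C_size /andP[w0 wK] := wC.
  have <- : `|(m' - a)%R|%N = offset w; last by lia.
  apply: offset_unique => //; first by lia.
  rewrite -[RHS]xw; apply/esym.
  have := @win_sub x z (m' - M%:Z) (- M%:Z) (M + M) (size w)
    `|(a - m' + M%:Z)%R|%N xm'.
  have -> : m' - M%:Z + `|(a - m' + M%:Z)%R|%N%:Z = a by lia.
  have -> : - M%:Z + `|(a - m' + M%:Z)%R|%N%:Z = - `|(m' - a)%R|%N%:Z by lia.
  by apply; lia.
have q1E : block_cut x m r j1 = m' - (offset c1)%:Z.
  by apply: occ => //; rewrite block_cutS -/c1 in j1lt; lia.
have q2E : block_cut x m' r' j2 = m' - (offset e)%:Z.
  by apply: occ => //; lia.
rewrite mem_cat; apply/orP; right; apply/allpairsP.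
exists ((c, c1), (e, e')); split; [exact/allpairs_f|exact/allpairs_f|] => /=.
have j1S := block_cutS x m r j1; rewrite -/c1 in j1S.
have offK : (offset c1 <= K)%N by lia.
pose l := (offset c1 + size e - offset e)%N.
have q'E : block_cut x m' r' j2.+1 = q + (size c)%:Z + l%:Z by rewrite /l; lia.
have dc := dC c cC; have de' := dC e' e'C.
(* The glue runs from the start of [c1] to the end of [e], inside the marker word, so it can be read
   in [z]. *)
have -> : win z (- (offset c1)%:Z) l = win x (q + (size c)%:Z) l.
  have := @win_sub x z (m' - M%:Z) (- M%:Z) (M + M) l (M - offset c1) xm'.
  have -> : m' - M%:Z + (M - offset c1)%N%:Z = q + (size c)%:Z by lia.
  have -> : - M%:Z + (M - offset c1)%N%:Z = - (offset c1)%:Z by lia.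
  by move=> -> //; rewrite /l; lia.
rewrite -(win_tiles dc de' xc xe' q'E); congr win; lia.
Qed.

Lemma tile_shift_sub k x q c : tile (shift_by k x) q c -> tile x (q + k) c.
Proof.
have wE p n : win (shift_by k x) (p - M%:Z) n = win x (p + k - M%:Z) n.
  by rewrite win_shift addrAC.
have mE p : marker (shift_by k x) p = marker x (p + k) by rewrite /marker wE.
move=> [m [r [j [[m1 m2 r0 nom] js [qE cE] mq qr]]]].
exists (m + k), r, j; split.
- split => //; [by rewrite -mE|by rewrite addrAC -mE|].
  by move=> i ir; rewrite addrAC -mE; exact: nom.
- by rewrite /block_words -wE.
- rewrite qE cE /block_cut /block_word /block_words wE; split => //.
  by move: (parse _) => so; move: (cut _ _) so.2 => a b; lia.
- by rewrite lerD2r.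
- by lia.
Qed.

Lemma tile_shift k x q c : tile (shift_by k x) q c <-> tile x (q + k) c.
Proof.
split=> [/tile_shift_sub //|t]; rewrite -(addrK k q).
by apply: tile_shift_sub; rewrite shift_byD addNr shift_by0.
Qed.

(** A tile starting in [[-K, 0]] lies in a block of length at most [R], and the text read extends
    [M] letters beyond it on both sides. *)
Lemma tile_agree x x' q (c : word) : subshift_set X x ->
  agree (K + R + M) x x' -> - K%:Z <= q -> q <= 0 -> tile x q c -> tile x' q c.
Proof.
move=> Xx xx' qK q0 t; have /andP[c0 cK] := tile_gt0 Xx t.
case: t => m [r [j [cons js [qE cE] mq qr]]].
have rR := consecutive_le Xx cons.
have mE (i : nat) : (i <= r)%N -> marker x (m + i%:Z) = marker x' (m + i%:Z).
  by move=> ir; rewrite /marker (agree_win xx') //; lia.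
have wE : win x (m - M%:Z) (r + (M + M)) = win x' (m - M%:Z) (r + (M + M)).
  by apply: agree_win xx' _ _; lia.
case: cons => m1 m2 r0 nom; exists m, r, j; split => //.
- split => //; [by rewrite -[m]addr0 -(mE 0%N) // addr0|by rewrite -mE|].
  by move=> i ir; rewrite -mE; [exact: nom | lia].
- by rewrite /block_words -wE.
- by rewrite qE cE /block_cut /block_word /block_words wE.
Qed.

Definition base : set full_shift := [set x | subshift_set X x /\
  exists q c, tile x q c /\ q + (delta c)%:Z = 0].

Hypothesis delta_le : forall c : word, (delta c <= size c)%N.
Hypothesis delta_lt : forall x q (c : word), subshift_set X x -> tile x q c ->
  (delta c < size c)%N.

Lemma base_nonempty : base !=set0.
Proof.
have [x Xx] := minimal_nonempty Xinf.
have [i _ xm] := marker_syndetic 0 Xx; set m := 0 + i%:Z in xm.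
have [r cons] := consecutive_exists Xx xm.
have rK := consecutive_gt Xx cons.
have [||j js /andP[jle jlt]] := @block_cover x m r Xx (m - 1); [lia|lia|].
have /C_size /andP[c0 cK] := block_word_in Xx js.
have jS := block_cutS x m r j.
have [||j3 js3 /andP[j3le j3lt]] :=
  @block_cover x m r Xx (block_cut x m r j.+1); [lia|lia|].
have {j3le j3lt} js3 : (j.+1 < size (block_words x m r))%N.
  by apply: leq_ltn_trans js3; rewrite -ltnS; exact: lt_block_cut j3lt.
have /C_size /andP[e0 eK] := block_word_in Xx js3.
pose q := block_cut x m r j.+1; pose c := block_word x m r j.+1.
have t : tile x q c.
  by exists m, r, j.+1; split => //; rewrite /q /c; lia.
exists (shift_by (q + (delta c)%:Z) x); split; first exact: subshift_shift.
exists (- (delta c)%:Z), c; split; last by rewrite addNr.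
by apply/tile_shift; rewrite addrC addrK.
Qed.

(** Since [delta c < size c] on tiles, base points come in the order of their tiles, so the next
    visit is the base point of the next tile. *)
Lemma base_return x : base x -> exists2 w, w \in return_words &
  [/\ (0 < size w)%N, win x 0 (size w) = w, base (shift_by (size w)%:Z x) &
      forall i : nat, (0 < i < size w)%N -> ~ base (shift_by i%:Z x)].
Proof.
move=> [Xx [q [c [t q0]]]].
have [q' [c' [t' qq' first_t]]] := tile_next Xx (in1W delta_le) t.
have dlt := delta_lt Xx t; have dlt' := delta_lt Xx t'.
have le1 := tile_disjoint t t' Xx qq'.
rewrite q0 subr0; set l := `|_|%N => wW.
have lE : l%:Z = q' + (delta c')%:Z by rewrite /l; lia.
exists (win x 0 l) => //; rewrite size_win; split => //; first by lia.
  split; first exact: subshift_shift.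
  exists (q' - l%:Z), c'; split; last by rewrite lE; lia.
  by apply/tile_shift; rewrite subrK.
move=> i il [_ [q'' [c'' [/tile_shift t'' q''0]]]].
have dlt'' := delta_lt Xx t''.
case: (ltgtP (q'' + i%:Z) q) => h.
- by have := tile_disjoint t'' t Xx h; lia.
- have := first_t _ _ t'' h; rewrite le_eqVlt => /predU1P[h'|h'].
    have cc : c' = c'' by move: t''; rewrite -h' => t''; exact: tile_unique t' t'' Xx.
    by move: lE; rewrite cc; lia.
  by have := tile_disjoint t' t'' Xx h'; lia.
- have cc : c = c'' by move: t''; rewrite h => t''; exact: tile_unique t t'' Xx.
  by move: q0; rewrite cc; lia.
Qed.

Lemma base_agree x x' : agree (K + R + M) x x' -> subshift_set X x' ->
  base x -> base x'.
Proof.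
move=> xx' Xx' [Xx [q [c [t q0]]]]; split => //; exists q, c; split => //.
have := delta_le c; have := tile_gt0 Xx t => cK dc.
by apply: tile_agree t => //; lia.
Qed.

End Markers.

Definition return_word (B : set full_shift) (x : full_shift) (w : word) : Prop :=
  [/\ (0 < size w)%N, win x 0 (size w) = w, B (shift_by (size w)%:Z x) &
      forall i : nat, (0 < i < size w)%N -> ~ B (shift_by i%:Z x)].

Lemma small_bases (X : subshift) :
  infinite_set (subshift_set X) -> minimal_subshift X ->
  finite_symbolic_rank (subshift_set X) ->
  exists d : nat, forall (y : full_shift) (N : nat), subshift_set X y ->
  exists (B : set full_shift) (W : seq word) (T : nat),
    [/\ B !=set0, B `<=` [set x | subshift_set X x /\ agree N y x],
        forall x x', agree T x x' -> subshift_set X x' -> B x -> B x',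
        (size W <= d)%N &
        forall x, B x -> exists2 w, w \in W & return_word B x w].
Proof.
move=> Xinf Xmin Xrank.
have [d dP] := finite_rank_dictionary Xinf Xmin Xrank.
exists (d ^ 2 + d ^ 4)%N => y N Xy; pose n := (N + N).+1.
have [G GP] := minimal_syndetic Xmin (- N%:Z) n Xy.
(* The central window of [y] starts within [G] letters of any position, so a word of this length
   occurring in [X] contains it. *)
have [C [Cd C_long C_parse]] := dP (G + n)%N.
pose K := (\max_(c <- C) size c)%N.
have C_size : {in C, forall c : word, (0 < size c <= K)%N}.
  move=> c cC; rewrite (leq_ltn_trans (leq0n _) (C_long c cC)) /=.
  exact: (@leq_bigmax_seq _ C xpredT size c).
have [z Xz z_sq] := no_centred_square Xinf Xmin K.
have [n0 n0P] := minimal_aperiodic Xinf Xmin (K + K).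
(* The bound [n0] is for sparseness: two markers at distance at most [K + K] would create that
   period on a stretch of [M + M > n0] letters. *)
pose M := (maxn K n0).+1.
have KM : (K <= M)%N by rewrite /M; lia.
have M0 : (0 < M)%N by [].
have [R RP] := minimal_syndetic Xmin (- M%:Z) (M + M) Xz.
have m_syn x (a : int) : subshift_set X x ->
    exists2 i : nat, (i < R)%N & marker z M x (a + i%:Z).
  move=> Xx; have [i iR e] := RP x (a - M%:Z) Xx; exists i => //.
  by rewrite /marker addrAC.
have m_sparse x m (r : nat) : subshift_set X x ->
    marker z M x m -> marker z M x (m + r%:Z) -> (0 < r)%N -> (K + K < r)%N.
  move=> Xx xm xr r0; rewrite ltnNge; apply/negP => rK.
  have [|i ii /negP] := n0P x (m - M%:Z) r Xx; first by rewrite r0.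
  apply; apply/eqP; have iM : (i < M + M)%N by rewrite /M; lia.
  rewrite (win_inj xm iM) -(win_inj xr iM); congr (x _); lia.
pose P (c : word) (i : nat) := take n (drop i c) == win y (- N%:Z) n.
(* The centre of the first occurrence of the window of [y] in [c]; the minimum keeps
   [delta c <= size c] for words without such an occurrence. *)
pose delta (c : word) := minn (size c) (find (P c) (iota 0 (size c)) + N).
have delta_le c : (delta c <= size c)%N by exact: geq_minl.
have deltaP x q c : subshift_set X x -> tile C z M x q c ->
    (delta c + N < size c)%N /\ win x (q + (delta c)%:Z - N%:Z) n = win y (- N%:Z) n.
  move=> Xx t; have [cC xc] := tile_word C_parse M0 KM Xx t.
  have [i iG xi] := GP x q Xx; have c_long := C_long c cC.
  have subE j : (j + n <= size c)%N -> take n (drop j c) = win x (q + j%:Z) n.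
    move=> jc; have jle : (j <= size c)%N by lia.
    by rewrite -{1}xc (win_drop x q jle) win_take //; lia.
  have Pi : P c i by rewrite /P subE ?xi //; lia.
  have hasP : has (P c) (iota 0 (size c)).
    by apply/hasP; exists i => //; rewrite mem_iota; lia.
  have fi : (find (P c) (iota 0 (size c)) <= i)%N.
    rewrite leqNgt; apply/negP => /(before_find 0%N).
    by rewrite nth_iota ?add0n ?Pi //; lia.
  have := nth_find 0%N hasP; rewrite nth_iota ?add0n; last by lia.
  have -> : delta c = (find (P c) (iota 0 (size c)) + N)%N.
    by rewrite /delta; apply/minn_idPr; lia.
  move: (find _ _) fi => f fi; rewrite /P subE; last by lia.
  by move=> /eqP <-; split; [lia | congr win; lia].
have delta_lt x q c : subshift_set X x -> tile C z M x q c -> (delta c < size c)%N.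
  by move=> Xx /(deltaP x q c Xx) []; lia.
exists (base X C z M delta), (return_words C z delta), (K + R + M)%N; split.
- exact: (base_nonempty Xinf C_size C_parse M0 KM m_syn m_sparse delta).
- move=> x [Xx [q [c [t q0]]]]; split => //; apply: agree_sym; apply: win_agree.
  by have [_] := deltaP x q c Xx t; rewrite q0 add0r.
- move=> x x' xx' Xx' Bx; exact: (base_agree C_size C_parse M0 KM m_syn delta_le xx' Xx' Bx).
- by rewrite size_return_words leq_add // leq_exp2r.
- move=> x Bx; exact: (base_return C_size C_parse z_sq M0 KM m_syn m_sparse delta_le delta_lt Bx).
Qed.

(** * The system of a minimal subshift *)

Section SubshiftSystem.
Variable X : subshift.

Lemma subshift_val (x : X) : subshift_set X (val x).
Proof. exact: set_mem (valP x). Qed.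

Lemma nbhs_subshift (x : X) (U : set X) :
  nbhs x U <-> exists N, forall y : X, agree N (val x) (val y) -> U y.
Proof.
split=> [[V [[W oW <-] Wx WU]]|[N NU]].
  have /nbhs_agree[N NW] : nbhs (val x) W by exact: open_nbhs_nbhs.
  by exists N => y xy; apply: WU; exact: NW.
have xN : nbhs x [set y : X | agree N (val x) (val y)].
  exact: (@initial_continuous X full_shift val x _ (agree_near (val x) N)).
by apply: filterS xN => y; exact: NU.
Qed.

Lemma subshift_space_compact : compact [set: X].
Proof.
move=> F FF _; pose G := val @ F : set_system full_shift.
have GF : ProperFilter G by exact: fmap_proper_filter.
have [|p [Xp pG]] := subshift_compact (X := X) GF.
  by apply: (@filterS _ F _ setT) => [x _|]; [exact: subshift_val|exact: filterT].
exists (exist _ p (mem_set Xp)); split => // A U FA /nbhs_subshift[N NU].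
have GA : G (val @` A) by apply: (@filterS _ F _ A) => // x Ax; exists x.
have [_ [[x Ax <-] xp]] := pG _ _ GA (agree_near p N).
by exists x; split => //; exact: NU.
Qed.

Lemma subshift_space_hausdorff : hausdorff_space X.
Proof.
apply: hausdorff_set_type; apply: hausdorff_product => n.
exact: discrete_hausdorff.
Qed.

Lemma subshift_space_zero_dimensional : zero_dimensional X.
Proof.
move=> x y /eqP xy.
have [N Nxy] : exists N, ~ agree N (val x) (val y).
  by apply/existsNP => h; apply: xy; apply: val_inj; exact: agree_eq.
exists [set z : X | agree N (val x) (val z)]; split => //; split.
  rewrite openE => z xz; apply/nbhs_subshift; exists N => w zw.
  exact: agree_trans xz zw.
move=> z zcl; have /zcl[w [/= xw zw]] : nbhs z [set w : X | agree N (val z) (val w)].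
  by apply/nbhs_subshift; exists N.
exact: agree_trans xw (agree_sym zw).
Qed.

Definition subshift_inv (x : X) : X :=
  exist _ (shift_by (- 1) (val x)) (mem_set (subshift_shift (- 1) (subshift_val x))).

Lemma subshift_mapK : cancel (@subshift_map X) subshift_inv.
Proof.
move=> x; apply: val_inj; rewrite /= /sigma shift_byD.
by rewrite addNr shift_by0.
Qed.

Lemma subshift_invK : cancel subshift_inv (@subshift_map X).
Proof.
move=> x; apply: val_inj; rewrite /= /sigma shift_byD.
by rewrite subrr shift_by0.
Qed.

Lemma shift_agree N k x y : agree (N + `|k|%N) x y ->
  agree N (shift_by k x) (shift_by k y).
Proof. by move=> xy i iN; apply: xy; lia. Qed.

Lemma subshift_map_continuous : continuous (@subshift_map X).
Proof.
move=> x U /nbhs_subshift[N NU]; apply/nbhs_subshift; exists (N + 1)%N => y xy.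
by apply: NU; exact: shift_agree.
Qed.

Lemma subshift_inv_continuous : continuous subshift_inv.
Proof.
move=> x U /nbhs_subshift[N NU]; apply/nbhs_subshift; exists (N + 1)%N => y xy.
by apply: NU; exact: shift_agree.
Qed.

Lemma iter_subshift_map i (x : X) :
  val (iter i (@subshift_map X) x) = shift_by i%:Z (val x).
Proof.
elim: i => [|i IH]; first by rewrite shift_by0.
by rewrite iterS /= IH /sigma shift_byD; congr shift_by; lia.
Qed.

Lemma iter_subshift_inv i (x : X) :
  val (iter i subshift_inv x) = shift_by (- i%:Z) (val x).
Proof.
elim: i => [|i IH]; first by rewrite shift_by0.
have -> : - i.+1%:Z = - 1 + - i%:Z by lia.
by rewrite -shift_byD -IH.
Qed.

(** * A metric for the subspace topology *)

Section Metric.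
Variable R : realType.

Lemma first_disagreement x y : x <> y ->
  exists k, forall n, agree n x y <-> (n < k)%N.
Proof.
move=> xy; have ex : exists k, ~~ `[< agree k x y >].
  apply: contrapT => /forallNP h; apply: xy; apply: agree_eq => N.
  by apply: contrapT => /asboolPn; exact: h.
case: (ex_minnP ex) => k /asboolPn kP kmin; exists k => n; split=> [nxy|nk].
  by rewrite ltnNge; apply/negP => kn; apply: kP; exact: agree_le nxy.
apply: contrapT => /asboolPn /kmin; rewrite leqNgt nk //.
Qed.

Definition word_dist (x y : int -> bool) : R :=
  if pselect (x = y) is right xy
  then (projT1 (cid (first_disagreement xy))).+1%:R^-1 else 0.

Lemma agree_dist n x y : agree n x y <-> word_dist x y < n.+1%:R^-1.
Proof.
rewrite /word_dist; case: pselect => [-> //|xy].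
  by split=> // _; rewrite invr_gt0 ltr0n.
case: cid => k /= ->; rewrite ltf_pV2 ?posrE ?ltr0n // ltr_nat ltnS.
by [].
Qed.

Lemma word_dist_cases x y : x = y \/ exists n,
  word_dist x y = n.+1%:R^-1 /\ ~ agree n x y.
Proof.
have [->|xy] := pselect (x = y); [by left|right].
rewrite /word_dist; case: pselect => // xy'; case: cid => k /= kP.
by exists k; split => // /kP; rewrite ltnn.
Qed.

Lemma word_dist_refl x : word_dist x x = 0.
Proof. by rewrite /word_dist; case: pselect. Qed.

Lemma word_dist_ge0 x y : 0 <= word_dist x y.
Proof.
by have [->|[n [-> _]]] := word_dist_cases x y; rewrite ?word_dist_refl ?invr_ge0 ?ler0n.
Qed.

Lemma word_dist_sym x y : word_dist x y = word_dist y x.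
Proof.
have le u v : word_dist u v <= word_dist v u.
  have [->//|[n [-> nuv]]] := word_dist_cases u v.
  rewrite leNgt; apply/negP => /agree_dist h; apply: nuv; exact: agree_sym.
by apply/eqP; rewrite eq_le !le.
Qed.

(** Agreement at a fixed radius is transitive, so this is even an ultrametric. *)
Lemma word_dist_triangle x y z : word_dist x z <= word_dist x y + word_dist y z.
Proof.
have [->|[n [-> nxz]]] := word_dist_cases x z.
  by rewrite word_dist_refl addr_ge0 ?word_dist_ge0.
have [xy|nxy] := pselect (agree n x y); last first.
  apply: ler_wpDr; first exact: word_dist_ge0.
  by rewrite leNgt; apply/negP => /agree_dist.
apply: ler_wpDl; first exact: word_dist_ge0.
rewrite leNgt; apply/negP => /agree_dist yz; apply: nxz.
exact: agree_trans xy yz.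
Qed.

Lemma subshift_metrizable : metrizable R X.
Proof.
exists (fun x y : X => word_dist (val x) (val y)); split.
- move=> x y; split=> [|->]; last exact: word_dist_refl.
  have [/val_inj//|[n [-> _]]] := word_dist_cases (val x) (val y).
  by move/eqP; rewrite invr_eq0 pnatr_eq0.
- by move=> x y; exact: word_dist_sym.
- by move=> x y z; exact: word_dist_triangle.
- move=> x A; split=> [/nbhs_subshift[N NA]|[e e0 eA]].
    exists N.+1%:R^-1; first by rewrite invr_gt0 ltr0n.
    by move=> y /agree_dist; exact: NA.
  apply/nbhs_subshift; exists (Num.trunc e^-1) => y /agree_dist xy; apply: eA.
  apply: lt_trans xy _; rewrite -[ltRHS]invrK ltf_pV2 ?posrE ?ltr0n ?invr_gt0 //.
  exact: Num.Theory.truncnS_gt.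
Qed.

End Metric.

(** * Recurrence, perfectness and minimality *)

Hypothesis Xinf : infinite_set (subshift_set X).
Hypothesis Xmin : minimal_subshift X.

Lemma subshift_space_nonempty : [set: X] !=set0.
Proof. by have [x Xx] := minimal_nonempty Xinf; exists (exist _ x (mem_set Xx)). Qed.

Lemma minimal_visits x y N (a : int) : subshift_set X x -> subshift_set X y ->
  exists G, exists2 i : nat, (i < G)%N & agree N y (shift_by (a - G%:Z + i%:Z) x).
Proof.
move=> Xx Xy.
have [G GP] := minimal_syndetic Xmin (- N%:Z) (N + N).+1 Xy.
exists G; have [i iG e] := GP x (a - G%:Z - N%:Z) Xx; exists i => //.
apply: agree_sym; apply: win_agree; rewrite win_shift -e; congr win; lia.
Qed.

Lemma minimal_visits_forward x y N : subshift_set X x -> subshift_set X y ->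
  exists i : nat, agree N y (shift_by i.+1%:Z x).
Proof.
move=> Xx Xy.
have [G GP] := minimal_syndetic Xmin (- N%:Z) (N + N).+1 Xy.
have [i iG e] := GP x (1 - N%:Z) Xx; exists i.
by apply: agree_sym; apply: win_agree; rewrite win_shift -e; congr win; lia.
Qed.

(** An isolated point would return to its isolating cylinder, hence to itself, and be periodic. *)
Lemma subshift_space_perfect : perfect_set [set: X].
Proof.
apply/perfectTP => x; rewrite openE => /(_ x erefl) /nbhs_subshift[N NP].
have Xx := subshift_val x.
have [i xi] := minimal_visits_forward N Xx Xx.
have := NP (iter i.+1 (@subshift_map X) x); rewrite iter_subshift_map => /(_ xi).
move=> /(congr1 (fun y : X => val y)); rewrite iter_subshift_map => e.
have [p /eqP] := minimal_aperiodic1 Xinf Xmin Xx (ltn0Sn i).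
by apply; rewrite -{1}e.
Qed.

Lemma subshift_cantor_system (R : realType) : cantor_system R (@subshift_map X).
Proof.
split.
- exact: subshift_space_nonempty.
- exact: subshift_metrizable.
- split.
  + exact: subshift_space_perfect.
  + exact: subshift_space_compact.
  + exact: subshift_space_hausdorff.
  + exact: subshift_space_zero_dimensional.
- split; first exact: subshift_map_continuous.
  exists subshift_inv; split.
  + exact: subshift_mapK.
  + exact: subshift_invK.
  + exact: subshift_inv_continuous.
Qed.

Lemma invariant_closed_full (Z : set X) :
  invariant_closed (@subshift_map X) Z -> Z = setT.
Proof.
move=> [[x Zx] cZ fZ]; apply/seteqP; split => // y _; apply: cZ => U /nbhs_subshift[N NU].
have [i yx] := minimal_visits_forward N (subshift_val x) (subshift_val y).
exists (iter i.+1 (@subshift_map X) x); split.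
  by elim: i.+1 => // k IH; rewrite iterS -fZ; exists (iter k (@subshift_map X) x).
by apply: NU; rewrite iter_subshift_map.
Qed.

Lemma subshift_essentially_minimal : essentially_minimal (@subshift_map X).
Proof.
have invT : invariant_closed (@subshift_map X) setT.
  split; [exact: subshift_space_nonempty|exact: closedT|].
  by apply/seteqP; split => // y _; exists (subshift_inv y) => //; exact: subshift_invK.
exists setT; split; first by split => // Z /invariant_closed_full.
by move=> Y [/invariant_closed_full].
Qed.

End SubshiftSystem.

(** * Nested bases *)

Lemma return_word_unique B x w w' : return_word B x w -> return_word B x w' -> w = w'.
Proof.
move=> [w0 xw Bw nw] [w0' xw' Bw' nw'].
have sz : size w = size w'.
  case: (ltngtP (size w) (size w')) => // h.
    by case: (nw' (size w)); rewrite ?w0.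
  by case: (nw (size w')); rewrite ?w0'.
by rewrite -xw -xw' sz.
Qed.

(* A sequence of clopen bases, the set [B n.+1] lying in a cylinder at least as
   precise as the window [rad n] needed to decide membership in [B n]. *)
Record base_sequence (X : subshift) (d : nat) (B : nat -> set full_shift)
    (W : nat -> seq word) (rad : nat -> nat) : Prop := BaseSequence {
  base_seq0 : B 0%N = subshift_set X;
  base_seq_sub : forall n, B n `<=` subshift_set X;
  base_seq_nonempty : forall n, B n !=set0;
  base_seq_window : forall n x x', agree (rad n) x x' -> subshift_set X x' ->
    B n x -> B n x';
  base_seqS : forall n, B n.+1 `<=` B n;
  base_seq_agree : forall n x y, B n.+1 x -> B n.+1 y -> agree (rad n + n) x y;
  base_seq_size : forall n, (size (W n.+1) <= d)%N;
  base_seq_return : forall n x, B n.+1 x ->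
    exists2 w, w \in W n.+1 & return_word (B n.+1) x w
}.

(** Inside [X], the cylinder of radius [rad n] around a point of [B n] stays in [B n]; [small_bases]
    at such a point with radius [rad n + n] gives the next base. *)
Lemma base_sequence_exists (X : subshift) :
  infinite_set (subshift_set X) -> minimal_subshift X ->
  finite_symbolic_rank (subshift_set X) ->
  exists d B W rad, base_sequence X d B W rad.
Proof.
move=> Xinf Xmin Xrank; have [d dP] := small_bases Xinf Xmin Xrank.
exists d; pose state := (set full_shift * seq word * nat)%type.
pose ok (s : state) := [/\ s.1.1 `<=` subshift_set X, s.1.1 !=set0 &
  forall x x', agree s.2 x x' -> subshift_set X x' -> s.1.1 x -> s.1.1 x'].
pose next (n : nat) (s s' : state) := [/\ ok s', s'.1.1 `<=` s.1.1,
  forall x y, s'.1.1 x -> s'.1.1 y -> agree (s.2 + n) x y,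
  (size s'.1.2 <= d)%N &
  forall x, s'.1.1 x -> exists2 w, w \in s'.1.2 & return_word s'.1.1 x w].
(* Guarding the conclusion by [ok] makes the step total, as [choice] requires. *)
have stepP (ns : nat * state) : exists s', ok ns.2 -> next ns.1 ns.2 s'.
  case: ns => n [[B W] r] /=; have [okB|nok] := pselect (ok (B, W, r)); last by exists (B, W, r).
  case: (okB) => /= BX [y By] Bw.
  have [B' [W' [r' [B'0 B'X B'w W'd B'ret]]]] := dP y (r + n)%N (BX _ By).
  exists (B', W', r') => _; split => //=.
  - by split => // x /B'X [].
  - by move=> x /B'X [Xx yx]; apply: Bw By => //; apply: agree_le yx; exact: leq_addr.
  - by move=> x x' /B'X [_ yx] /B'X [_ yx']; exact: agree_trans (agree_sym yx) yx'.
have [F FP] := choice stepP.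
pose s := fix s (n : nat) : state :=
  if n is n'.+1 then F (n', s n') else (subshift_set X, [::], 0%N).
have oks n : ok (s n).
  elim: n => [|n IH] /=; last by have [] := FP (n, s n) IH.
  by split => //; exact: minimal_nonempty.
exists (fun n => (s n).1.1), (fun n => (s n).1.2), (fun n => (s n).2); split => //.
- by move=> n; case: (oks n).
- by move=> n; case: (oks n).
- by move=> n; case: (oks n).
- by move=> n; have [] := FP (n, s n) (oks n).
- by move=> n x y; have [_ _ h _ _] := FP (n, s n) (oks n); exact: h.
- by move=> n; have [] := FP (n, s n) (oks n).
- by move=> n; have [] := FP (n, s n) (oks n).
Qed.

(** * Towers over the nested bases *)

Section SubshiftTowers.
Variable X : subshift.
Hypothesis Xinf : infinite_set (subshift_set X).
Hypothesis Xmin : minimal_subshift X.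
Variables (d : nat) (B : nat -> set full_shift) (W : nat -> seq word) (rad : nat -> nat).
Hypothesis BW : base_sequence X d B W rad.

Definition tower_base (n : nat) : set X := [set x | B n (val x)].

(** At stage 0 the return words would be single letters, possibly two of them; a constant label of
    height 1 gives the single root vertex instead. *)
Definition tower_label (n : nat) (x : X) : word :=
  if n is _.+1 then xget [::] (return_word (B n) (val x)) else [::].

Arguments tower_label : simpl never.

Definition tower_height (n : nat) (w : word) : nat := if n is 0%N then 1%N else size w.

(** [W n] is only a list of candidates; restricting it to labels that occur makes every vertex a
    nonempty tower. *)
Definition tower_labels (n : nat) : seq word :=
  undup [seq w <- if n is 0%N then [:: [::]] else W n |
         `[< exists2 y : X, tower_base n y & tower_label n y = w >]].

Lemma tower_labelP n (x : X) : tower_base n.+1 x ->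
  return_word (B n.+1) (val x) (tower_label n.+1 x).
Proof.
by move=> Bx; have [w _ xw] := base_seq_return BW Bx; exact: (xgetI [::] xw).
Qed.

Lemma tower_label_eq n (x : X) w : return_word (B n.+1) (val x) w ->
  tower_label n.+1 x = w.
Proof. by move=> xw; have := xgetI [::] xw => xw'; exact: return_word_unique xw' xw. Qed.

Lemma tower_label_in n (x : X) : tower_base n.+1 x -> tower_label n.+1 x \in W n.+1.
Proof.
by move=> Bx; have [w wW xw] := base_seq_return BW Bx; rewrite (tower_label_eq xw).
Qed.

Lemma return_word_agree n (x y : X) (i k : nat) (w : word) :
  (forall j : nat, (j <= k)%N ->
    agree (rad n) (shift_by (i + j)%N%:Z (val x)) (shift_by (i + j)%N%:Z (val y))) ->
  (size w <= k)%N -> return_word (B n) (shift_by i%:Z (val x)) w ->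
  return_word (B n) (shift_by i%:Z (val y)) w.
Proof.
move=> xy wk [w0 xw Bw nw].
have sh (z : X) (j : nat) :
    shift_by j%:Z (shift_by i%:Z (val z)) = shift_by (i + j)%N%:Z (val z).
  by rewrite shift_byD PoszD addrC.
have BE (j : nat) : (j <= k)%N ->
    B n (shift_by (i + j)%N%:Z (val x)) <-> B n (shift_by (i + j)%N%:Z (val y)).
  move=> jk; have a := xy j jk; split.
    exact: (base_seq_window BW a (subshift_shift _ (subshift_val y))).
  exact: (base_seq_window BW (agree_sym a) (subshift_shift _ (subshift_val x))).
split => //.
- rewrite -[RHS]xw; apply: eq_win => j jw; rewrite add0r.
  have /(_ 0 isT) := xy j (leq_trans (ltnW jw) wk).
  by rewrite -!sh /shift_by !add0r => ->.
- by rewrite sh -BE // -sh.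
- by move=> j jw; rewrite sh -BE ?(leq_trans _ wk) 1?ltnW ?(andP jw).2 // -sh; exact: nw.
Qed.

(** Left of 0 the points agree because both lie in the base, from the return on because both are
    back in it, and in between they read the same return word. *)
Lemma tower_agree n (x y : X) : tower_base n.+1 x -> tower_base n.+1 y ->
  tower_label n.+1 x = tower_label n.+1 y ->
  forall j : nat, (j <= size (tower_label n.+1 x))%N ->
  agree (rad n + n) (shift_by j%:Z (val x)) (shift_by j%:Z (val y)).
Proof.
move=> Bx By xy j jw; have := tower_labelP Bx; have := tower_labelP By.
rewrite -xy; set w := tower_label _ _ in jw * => -[_ yw Byw _] [_ xw Bxw _].
have a0 := base_seq_agree BW Bx By; have a1 := base_seq_agree BW Bxw Byw.
move=> i iN; rewrite /shift_by.
case: (ltP (i + j%:Z) 0) => h0; first by apply: a0; lia.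
case: (ltP (i + j%:Z) (size w)%:Z) => h1.
  have e : win (val x) 0 (size w) = win (val y) 0 (size w) by rewrite xw yw.
  by rewrite (win_at e h0) ?add0r // subr0 addr0.
have := a1 (i + j%:Z - (size w)%:Z); rewrite /shift_by subrK; apply; lia.
Qed.

Lemma tower_refines n (x y : X) (i : nat) : tower_base n.+1 x -> tower_base n.+1 y ->
  tower_label n.+1 x = tower_label n.+1 y ->
  (i < tower_height n.+1 (tower_label n.+1 x))%N ->
  tower_base n (iter i (@subshift_map X) x) ->
  tower_base n (iter i (@subshift_map X) y) /\
  tower_label n (iter i (@subshift_map X) x) =
  tower_label n (iter i (@subshift_map X) y).
Proof.
move=> Bx By xy /= iw; rewrite /tower_base /= !iter_subshift_map => Bix.
have ag := tower_agree Bx By xy.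
have ag' (j : nat) : (j <= size (tower_label n.+1 x) - i)%N ->
    agree (rad n) (shift_by (i + j)%N%:Z (val x)) (shift_by (i + j)%N%:Z (val y)).
  by move=> jw; apply: (agree_le (leq_addr n _)); apply: ag; lia.
have Biy : B n (shift_by i%:Z (val y)).
  apply: (base_seq_window BW _ _ Bix); last exact/subshift_shift/subshift_val.
  by have := ag' 0%N; rewrite addn0; exact.
split => //; case: n Bx By xy iw Bix ag ag' Biy => // n Bx By xy iw Bix ag ag' Biy.
have Bx' : tower_base n.+1 (iter i (@subshift_map X) x).
  by rewrite /tower_base /= iter_subshift_map.
have := tower_labelP Bx'; set w := tower_label _ _; rewrite iter_subshift_map => xw.
apply/esym/tower_label_eq; rewrite iter_subshift_map.
apply: (return_word_agree ag' _ xw).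
(* The return to [B n.+2] is also a visit to the larger base [B n.+1], so the return word starting
   at level [i] ends by then. *)
rewrite leqNgt; apply/negP => lt; case: xw => _ _ _.
move=> /(_ (size (tower_label n.+2 x) - i)%N) []; first by rewrite lt subn_gt0 iw.
have [_ _ Bxw _] := tower_labelP Bx; rewrite shift_byD.
have -> : (size (tower_label n.+2 x) - i)%N%:Z + i%:Z =
          (size (tower_label n.+2 x))%:Z by lia.
exact: (base_seqS BW Bxw).
Qed.

Lemma tower_visits n (x : X) : exists i, tower_base n (iter i (@subshift_inv X) x).
Proof.
have [y By] := base_seq_nonempty BW n; have Xy := base_seq_sub BW By.
have [G [i iG yx]] := minimal_visits Xmin (rad n) 0 (subshift_val x) Xy.
exists (G - i)%N; rewrite /tower_base /= iter_subshift_inv.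
apply: (base_seq_window BW _ _ By); last exact/subshift_shift/subshift_val.
by have -> : - (G - i)%N%:Z = 0 - G%:Z + i%:Z by lia.
Qed.

Lemma tower_label_near n (x : X) : tower_base n x ->
  \forall z \near x, tower_base n z /\ tower_label n z = tower_label n x.
Proof.
case: n => [|n] Bx; apply/nbhs_subshift.
  by exists 0%N => z _; split => //; rewrite /tower_base /= (base_seq0 BW); exact: subshift_val.
have xw := tower_labelP Bx; set w := tower_label _ _ in xw *.
exists (rad n.+1 + size w)%N => z xz.
have ag (j : nat) : (j <= size w)%N ->
    agree (rad n.+1) (shift_by (0 + j)%N%:Z (val x)) (shift_by (0 + j)%N%:Z (val z)).
  by move=> jw; apply: shift_agree; apply: agree_le xz; rewrite leq_add2l.
split.
  apply: (base_seq_window BW _ _ Bx); last exact: subshift_val.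
  by apply: agree_le xz; exact: leq_addr.
apply: tower_label_eq; rewrite -[val z]shift_by0.
by apply: (return_word_agree ag) => //; rewrite shift_by0.
Qed.

Lemma mem_tower_labels n w : w \in tower_labels n <->
  exists2 y : X, tower_base n y & tower_label n y = w.
Proof.
rewrite mem_undup mem_filter; split=> [/andP[/asboolP]//|yw].
apply/andP; split; first exact/asboolP.
case: yw; case: n => [|n] y By <-; first by rewrite inE.
exact: tower_label_in.
Qed.

Lemma tower_baseS n : tower_base n.+1 `<=` tower_base n.
Proof. by move=> x Bx; exact: (base_seqS BW Bx). Qed.

Lemma tower_base0 (x : X) : tower_base 0 x.
Proof. by rewrite /tower_base /= (base_seq0 BW); exact: subshift_val. Qed.

Lemma size_tower_labels n : (size (tower_labels n.+1) <= d)%N.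
Proof.
apply: leq_trans (size_undup _) _; rewrite size_filter.
exact: leq_trans (count_size _ _) (base_seq_size BW n).
Qed.

Lemma size_tower_labels0 : size (tower_labels 0) = 1%N.
Proof.
rewrite /tower_labels /=; case: asboolP => //= -[].
by have [x _] := subshift_space_nonempty Xinf; exists x => //; exact: tower_base0.
Qed.

Lemma tower_height_gt0 n (x : X) : tower_base n x ->
  (0 < tower_height n (tower_label n x))%N.
Proof. by case: n => // n /tower_labelP []. Qed.

Lemma tower_base_height n (x : X) : tower_base n x ->
  tower_base n (iter (tower_height n (tower_label n x)) (@subshift_map X) x).
Proof.
case: n => [|n] Bx; first exact: tower_base0.
by rewrite /tower_base /= iter_subshift_map; have [] := tower_labelP Bx.
Qed.

Lemma tower_base_lt_height n (x : X) i : tower_base n x ->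
  (0 < i < tower_height n (tower_label n x))%N ->
  ~ tower_base n (iter i (@subshift_map X) x).
Proof.
case: n => [|n] Bx iw; first by move: iw => /=; lia.
by rewrite /tower_base /= iter_subshift_map; have [_ _ _] := tower_labelP Bx; apply.
Qed.

(** In the radius [rad n + n] the first summand serves refinement, the second separates points. *)
Lemma tower_separates (x y : X) : (forall n, exists x' y' i,
  [/\ tower_base n.+1 x', tower_base n.+1 y',
      tower_label n.+1 x' = tower_label n.+1 y',
      (i < tower_height n.+1 (tower_label n.+1 x'))%N &
      x = iter i (@subshift_map X) x' /\ y = iter i (@subshift_map X) y']) ->
  x = y.
Proof.
move=> h; apply: val_inj; apply: agree_eq => n.
have [x' [y' [i [Bx By xy iw [-> ->]]]]] := h n.
rewrite !iter_subshift_map; apply: (agree_le (leq_addl (rad n) n)).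
by apply: tower_agree => //; exact: ltnW.
Qed.

Lemma tower_bases_meet (x y : X) :
  (forall n, tower_base n x) -> (forall n, tower_base n y) -> x = y.
Proof.
move=> Bx By; apply: val_inj; apply: agree_eq => n.
by apply: (agree_le (leq_addl (rad n) n)); exact: (base_seq_agree BW (Bx n.+1) (By n.+1)).
Qed.

Lemma subshift_bratteli : exists D : ordered_bratteli,
  [/\ essentially_simple D, forall n, (#|bvertex D n.+1| <= d)%N &
      conjugate (@subshift_map X) (@vershik D)].
Proof.
have uniqL n : uniq (tower_labels n) by exact: undup_uniq.
exists (tower_diagram (@subshift_mapK X) (@subshift_invK X)
  (subshift_space_nonempty Xinf) uniqL mem_tower_labels size_tower_labels0
  tower_baseS tower_height_gt0 tower_base_height tower_base_lt_height
  tower_refines tower_visits); split.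
- apply: tower_essentially_simple.
  + exact: subshift_inv_continuous.
  + exact: subshift_space_compact.
  + exact: tower_base0.
  + exact: tower_label_near.
  + exact: tower_bases_meet.
- by move=> n; rewrite card_tower_vertex; exact: size_tower_labels.
- apply: tower_conjugate.
  + exact: subshift_inv_continuous.
  + exact: subshift_space_compact.
  + exact: tower_base0.
  + exact: tower_label_near.
  + exact: tower_separates.
  + exact: tower_bases_meet.
Qed.

End SubshiftTowers.

Theorem theorem6p7 (R : realType) (X : subshift) :
  infinite_set (subshift_set X) ->
  minimal_subshift X ->
  finite_symbolic_rank (subshift_set X) ->
  finite_topological_rank R (@subshift_map X).
Proof.
move=> Xinf Xmin Xrank; split.
- exact: subshift_cantor_system.
- exact: subshift_essentially_minimal.
- have [d [B [W [rad BW]]]] := base_sequence_exists Xinf Xmin Xrank.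
  by exists d; exact: subshift_bratteli BW.
Qed.
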